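(* Let $K\subset\mathbb{R}^n$ be a compact convex set whose interior contains the origin, with gauge function $\gamma$, and let $\gamma^\circ$ be the gauge function of the polar $K^\circ$. Let $U\subset\mathbb{R}^n$ be a bounded open set such that $\partial U$ is $C^{k,\alpha}$, where $k\ge 1$ is an integer and $0\le\alpha\le 1$, and let $\nu$ be the inward unit normal to $\partial U$. Let $\rho(x)=\min_{y\in\partial U}\gamma(x-y)$. Let $x_0\in U$ and suppose $y_0\in\partial U$ is the unique $\rho$-closest point on $\partial U$ to $x_0$. Furthermore, suppose that $\nu_0=\nu(y_0)$ is an interior point of the normal cone $N\big(K,\tfrac{x_0-y_0}{\rho(x_0)}\big)$. Then $\rho$ is $C^{k,\alpha}$ on a neighborhood of $x_0$, and every point $x$ near $x_0$ has a unique $\rho$-closest point $y=y(x)\in\partial U$, and this point is near $y_0$ (i.e. for every neighborhood $V$ of $y_0$ we have $y(x)\in V$ for all $x$ sufficiently close to $x_0$). In addition, for $x$ near $x_0$ and $y=y(x)$, $$D\rho(x)=\mu(y):=\frac{\nu(y)}{\gamma^\circ(\nu(y))}.$$ Also, $y$ is a $C^{k,\alpha}$ function of $x$ (near $x_0$), $\gamma^\circ$ is differentiable at $\nu=\nu(y)$, and $$Dy(x)=I-X(\nu)=I-\frac{1}{\gamma^\circ(\nu)}D\gamma^\circ(\nu)\otimes\nu .$$ Furthermore, when $k\ge 2$, with $X=X(\nu)$, $$D^2\rho(x)=\frac{1}{\gamma^\circ(\nu)}(I-X^{T})\,D^2d(y)\,(I-X),$$ where $d(\cdot):=\min_{z\in\partial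 U}|\cdot-z|$ is the Euclidean distance to $\partial U$.
   Context: The gauge function of a compact convex set $K$ with $0\in\mathrm{int}(K)$ is $\gamma(x)=\inf\{\lambda>0:\tfrac1\lambda x\in K\}$ (it need not be symmetric). The polar is $K^\circ=\{x:\langle x,y\rangle\le 1\text{ for all }y\in K\}$, again a compact convex set with $0$ in its interior; $\gamma^\circ$ is its gauge function. For $x\in\partial K$, the normal cone is $N(K,x)=\{v\in\mathbb{R}^n:\langle y-x,v\rangle\le 0\text{ for all }y\in K\}$. A point $y\in\partial U$ is called a $\rho$-closest point to $x$ on $\partial U$ if $\rho(x)=\gamma(x-y)$. For vectors $a,b$, $a\otimes b$ is the matrix acting by $(a\otimes b)z=\langle z,b\rangle a$. When $\gamma^\circ$ is differentiable at $v\neq 0$, $X(v):=\frac{1}{\gamma^\circ(v)}D\gamma^\circ(v)\otimes v$. $I$ is the $n\times n$ identity matrix and $Dy(x)$ is the $n\times n$ Jacobian matrix. $|\cdot|$ is the Euclidean norm. At a boundary point $y\in\partial U$, $D^2d(y)$ is understood for $d$ as a function on $\overline U$ near $\partial U$ (derivatives taken up to the boundary from inside $U$), where $Dd=\nu$ on $\partial U$; thus $Dd$ is a $C^{k-1,\alpha}$ extension of $\nu$, and the eigenvalues of $D^2d(y)=D\nu(y)$ are minus the principal curvatures of $\partial U$ at $y$ together with one eigenvalue $0$. *)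

(* Defs.v *)
From mathcomp Require Export all_boot all_order all_algebra.
From mathcomp Require Export all_classical all_reals all_analysis.
Export Order.TTheory GRing.Theory Num.Theory numFieldNormedType.Exports.

#[export] Set Implicit Arguments.
#[export] Unset Strict Implicit.
#[export] Unset Printing Implicit Defensive.

Local Open Scope classical_set_scope.
Local Open Scope ring_scope.

(* Points of R^n are row vectors.  The norm `|x| that the library puts on
   'rV[R]_n is the sup norm; it is used here only where replacing it by the
   Euclidean norm changes nothing (topology, boundedness, Hoelder constants). *)

Section Geometry.
Context {R : realType} {n : nat}.
Implicit Types (K U A : set 'rV[R]_n) (x y v a b : 'rV[R]_n).

Definition dot x y : R := (x *m y^T) 0 0.

Definition enorm x : R := Num.sqrt (dot x x).

Definition boundary A : set 'rV[R]_n := closure A `\` A°.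

Definition gauge K x : R := inf [set l : R | 0 < l /\ K (l^-1 *: x)].

Definition polar K : set 'rV[R]_n := [set x | forall y, K y -> dot x y <= 1].

Definition normal_cone K x : set 'rV[R]_n :=
  [set v | forall y, K y -> dot (y - x) v <= 0].

(* For U bounded and nonempty the infima in gauge_dist and edist are attained. *)
Definition gauge_dist K U x : R := inf [set gauge K (x - y) | y in boundary U].

Definition edist U x : R := inf [set enorm (x - y) | y in boundary U].

Definition closest_point K U x y : Prop :=
  boundary U y /\ gauge_dist K U x = gauge K (x - y).

(* With rows as vectors, (a (x) b) z = <z, b> a reads
   tensor a b *m z^T = dot z b *: a^T. *)
Definition tensor a b : 'M[R]_n := a^T *m b.

Definition grad (f : 'rV[R]_n -> R) x : 'rV[R]_n :=
  \row_i 'D_(delta_mx 0 i) f x.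

(* The library's 'J f x acts on rows from the right ('D_v f x = v *m 'J f x),
   so the usual Jacobian, with entry (i, j) equal to d f_i / d x_j, is its
   transpose. *)
Definition Dmx (f : 'rV[R]_n -> 'rV[R]_n) x : 'M[R]_n := ('J f x)^T.

Definition hessian (f : 'rV[R]_n -> R) x : 'M[R]_n := Dmx (grad f) x.

(* X(v) = (1 / g(v)) Dg(v) (x) v, where g is the gauge of the polar of K. *)
Definition Xmx K v : 'M[R]_n :=
  (gauge (polar K) v)^-1 *: tensor (grad (gauge (polar K)) v) v.

End Geometry.

Section Regularity.
Context {R : realType} {n : nat} {W : normedModType R}.

(* Local Hoelder continuity; as 0 `^ 0 = 1, for alpha = 0 this is just local
   boundedness. *)
Definition holder_on (alpha : R) (f : 'rV[R]_n -> W) (A : set 'rV[R]_n) : Prop :=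
  forall x, A x -> exists C : R,
    \forall u \near x & v \near x, `|f u - f v| <= C * `|u - v| `^ alpha.

(* C^{k,alpha} on an open set A: all partial derivatives of order at most k
   exist and are continuous on A, those of order k being locally
   alpha-Hoelder.  In particular Ckalpha k 0 is C^k. *)
Fixpoint Ckalpha (k : nat) (alpha : R) (f : 'rV[R]_n -> W)
    (A : set 'rV[R]_n) {struct k} : Prop :=
  (forall x, A x -> {for x, continuous f}) /\
  match k with
  | 0%N => holder_on alpha f A
  | j.+1 => forall i : 'I_n,
      (forall x, A x -> derivable f x (delta_mx 0 i)) /\
      Ckalpha j alpha (fun x => 'D_(delta_mx 0 i) f x) A
  end.

End Regularity.

Section Boundary.
Context {R : realType} {n : nat}.
Implicit Types (U : set 'rV[R]_n) (y v : 'rV[R]_n).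

(* Near each boundary point, U is the region strictly above the graph of a
   C^{k,alpha} function over a hyperplane.  A function on the hyperplane
   orthogonal to the unit vector e is encoded as a function phi on R^n which is
   constant along e; the coordinate of x in the direction e is dot x e. *)
Definition Ckalpha_boundary (k : nat) (alpha : R) U : Prop :=
  forall y, boundary U y ->
  exists (e : 'rV[R]_n) (phi : 'rV[R]_n -> R) (V : set 'rV[R]_n),
    [/\ enorm e = 1,
        forall x t, phi (x + t *: e) = phi x,
        open V /\ V y,
        Ckalpha k alpha phi V &
        forall x, V x -> (U x <-> phi x < dot x e)].

(* v is a unit vector orthogonal to the tangent space of the boundary at y (the
   velocities at y of curves in the boundary) and it points into U. *)
Definition inward_unit_normal U y v : Prop :=
  [/\ enorm v = 1,
      forall c : R -> 'rV[R]_n,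
        c 0 = y -> (\forall t \near (0 : R), boundary U (c t)) ->
        derivable c 0 1 -> dot ('D_1 c 0) v = 0 &
      \forall t \near (0 : R)^'+, U (y + t *: v)].

(* H is the value at the boundary point y of the second derivative of f taken
   up to the boundary from inside U: f is C^2 in U near y, and H is the value
   at y of the continuous extension of its Hessian. *)
Definition hessian_from_inside U (f : 'rV[R]_n -> R) y (H : 'M[R]_n) : Prop :=
  (exists V : set 'rV[R]_n, [/\ open V, V y & Ckalpha 2 0 f (U `&` V)]) /\
  hessian f x @[x --> within U (nbhs y)] --> H.

End Boundary.

(* Main.v *)
Require Import Defs.
From HB Require Import structures.
From mathcomp Require Import ring lra.
Local Open Scope classical_set_scope.
Local Open Scope ring_scope.

(** Write rho for [gauge_dist K U], gamma for the gauge of [K], and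
    z0 = (x0 - y0) / rho(x0), a boundary point of [K].

    The normal nu(y0) is interior to the normal cone of [K] at z0, so [K] has a
    corner at z0. For v near nu(y0) the linear form <., v> attains its maximum over [K]
    at z0; hence the polar gauge is the linear function <z0, v> near nu(y0)
    ([gauge_polar_normal_cone]), and gamma(w) >= <w, v> / <z0, v> for all such v
    and all w ([gauge_ge_dot]).

    These bounds fix the direction of the closest point. Suppose that the ray from x
    in the direction -z0 meets the boundary near y0 at a = x - t z0, and let p be
    another boundary point near y0. Chords of a C^1 boundary are almost orthogonal to
    the normal, so some v near nu(y0) has <a - p, v> > 0 ([boundary_chord]). As
    x - p = t z0 + (a - p), the bound for this v gives gamma(x - p) > t >=
    gamma(x - a). For x near x0 the ray does meet the boundary
    ([boundary_crossing]) and compactness keeps all closest points near y0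
    ([qdist_closest_near]), so y(x) = x - rho(x) z0 is the only closest point
    ([closest_point_near]).

    The boundary is locally the zero set of a C^{k,alpha} function Phi, the height
    above the graph, and nu = grad Phi / |grad Phi| on it
    ([local_defining_function], [ld_normal]). Expanding Phi(x - rho(x) z0) = 0 gives
    D rho(x) = G(y(x)) with G = nu / <z0, nu> ([ray_frechet]), and then
    Dy = I - X. For the regularity, the derivative of f o y along e_i is (L_i f) o y,
    where L_i f = d_i f - G_i sum_j z0_j d_j f has one derivative less than f. By
    induction f o y is as regular as f up to order k ([Ckalpha_ray]); with f = G_i
    this makes rho, and with it y, of class C^{k,alpha}.

    For k >= 2 the Euclidean distance d is studied through its foot map. A closest
    point p of x satisfies x = p + d m(p), where m = grad Phi / |grad Phi|. Where d
    times the Lipschitz constant of m is at most 1/2 this relation makes p Lipschitz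
    ([foot_map_exists]); then Dd = m o p ([edist_frechet]), and differentiating the
    relation gives Dp (I + d Dm) = I - m^T m in the convention where Jacobians act on
    rows ([foot_is_diff]). So d is C^2 up to the boundary, and at y its Hessian is
    Dm(y) (I - m m^T) in the usual convention ([edist_hessian]). Differentiating
    G o y gives the same formula for D^2 rho without the projection I - m m^T, which
    I - X absorbs ([hessian_algebra]). *)

(** * The dot product and the two norms on row vectors *)

Section DotProduct.
Context {R : realType} {n : nat}.
Implicit Types (x y z : 'rV[R]_n) (a : R).

Lemma dotE x y : dot x y = \sum_i x 0 i * y 0 i.
Proof. by rewrite /dot mxE; apply: eq_bigr => i _; rewrite mxE. Qed.

Lemma dotC x y : dot x y = dot y x.
Proof. by rewrite !dotE; apply: eq_bigr => i _; rewrite mulrC. Qed.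

Lemma dotDl x y z : dot (x + y) z = dot x z + dot y z.
Proof. by rewrite /dot mulmxDl mxE. Qed.

Lemma dotDr x y z : dot z (x + y) = dot z x + dot z y.
Proof. by rewrite dotC dotDl !(dotC z). Qed.

Lemma dotZl a x y : dot (a *: x) y = a * dot x y.
Proof. by rewrite /dot -scalemxAl mxE. Qed.

Lemma dotZr a x y : dot x (a *: y) = a * dot x y.
Proof. by rewrite dotC dotZl dotC. Qed.

Lemma dotNl x y : dot (- x) y = - dot x y.
Proof. by rewrite -scaleN1r dotZl mulN1r. Qed.

Lemma dotNr x y : dot x (- y) = - dot x y.
Proof. by rewrite dotC dotNl dotC. Qed.

Lemma dotBl x y z : dot (x - y) z = dot x z - dot y z.
Proof. by rewrite dotDl dotNl. Qed.

Lemma dotBr x y z : dot z (x - y) = dot z x - dot z y.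
Proof. by rewrite dotDr dotNr. Qed.

Lemma dot0l x : dot 0 x = 0.
Proof. by rewrite /dot mul0mx mxE. Qed.

Lemma dot0r x : dot x 0 = 0.
Proof. by rewrite dotC dot0l. Qed.

Lemma dot_delta x i : dot (delta_mx 0 i) x = x 0 i.
Proof.
rewrite dotE (bigD1 i) //= big1 ?addr0 => [|j ji]; rewrite mxE ?eqxx ?mul1r //.
by rewrite (negbTE ji) mul0r.
Qed.

Lemma mul_outer x y z : x *m (y^T *m z) = dot x y *: z.
Proof.
by rewrite mulmxA [x *m y^T]mx11_scalar mul_scalar_mx.
Qed.

Lemma entry_le_norm x i : `|x 0 i| <= `|x|.
Proof.
rewrite [leRHS]/Num.Def.normr /= mx_normrE.
exact: (le_bigmax _ (fun ij : 'I_1 * 'I_n => `|x ij.1 ij.2|) (0, i)).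
Qed.

Lemma norm_le_entries x a : 0 <= a -> (forall i, `|x 0 i| <= a) -> `|x| <= a.
Proof.
move=> a0 xa; rewrite [leLHS]/Num.Def.normr /= mx_normrE.
by apply: bigmax_le => // -[i j] _ /=; rewrite (ord1 i).
Qed.

Lemma norm_dot_le x y : `|dot x y| <= n%:R * `|x| * `|y|.
Proof.
rewrite dotE (le_trans (ler_norm_sum _ _ _)) //.
rewrite -mulrA mulr_natl -[X in _ *+ X]card_ord -sumr_const ler_sum // => i _.
by rewrite normrM ler_pM // entry_le_norm.
Qed.

Lemma dot_ge0 x : 0 <= dot x x.
Proof. by rewrite dotE sumr_ge0 // => i _; rewrite -expr2 sqr_ge0. Qed.

Lemma sqr_norm_le_dot x : `|x| ^+ 2 <= dot x x.
Proof.
rewrite -[leRHS]sqr_sqrtr ?dot_ge0 // ler_sqr ?nnegrE ?sqrtr_ge0 //.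
apply: norm_le_entries => [|i]; first exact: sqrtr_ge0.
rewrite -sqrtr_sqr ler_wsqrtr // dotE (bigD1 i) //= expr2 lerDl.
by rewrite sumr_ge0 // => j _; rewrite -expr2 sqr_ge0.
Qed.

Lemma dot_eq0 x : dot x x = 0 -> x = 0.
Proof.
move=> x0; have := sqr_norm_le_dot x; rewrite x0 => h.
by apply/eqP; rewrite -normr_eq0 -sqrf_eq0 eq_le h sqr_ge0.
Qed.

Lemma dot_gt0 x : x != 0 -> 0 < dot x x.
Proof.
by move=> x0; rewrite lt_neqAle dot_ge0 andbT eq_sym; apply: contra_neq x0 => /dot_eq0.
Qed.

Lemma enorm_ge0 x : 0 <= enorm x.
Proof. exact: sqrtr_ge0. Qed.

Lemma sqr_enorm x : enorm x ^+ 2 = dot x x.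
Proof. by rewrite sqr_sqrtr ?dot_ge0. Qed.

Lemma enorm0 : enorm (0 : 'rV[R]_n) = 0.
Proof. by rewrite /enorm dot0l sqrtr0. Qed.

Lemma enormZ a x : enorm (a *: x) = `|a| * enorm x.
Proof.
by rewrite /enorm dotZl dotZr mulrA -expr2 sqrtrM ?sqr_ge0 // sqrtr_sqr.
Qed.

Lemma norm_le_enorm x : `|x| <= enorm x.
Proof. by rewrite -ler_sqr ?nnegrE ?enorm_ge0 // sqr_enorm sqr_norm_le_dot. Qed.

Lemma enorm_gt0 x : x != 0 -> 0 < enorm x.
Proof. by move=> x0; rewrite sqrtr_gt0 dot_gt0. Qed.

Lemma enorm_le x : enorm x <= n%:R * `|x|.
Proof.
rewrite -ler_sqr ?nnegrE ?enorm_ge0 ?mulr_ge0 // sqr_enorm.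
apply: le_trans (le_trans (ler_norm _) (norm_dot_le _ _)) _.
rewrite exprMn -mulrA -expr2 ler_wpM2r ?sqr_ge0 // -natrX ler_nat.
by case: (n) => // m; rewrite expnS leq_pmulr // expn1.
Qed.

Lemma cauchy_schwarz x y : dot x y <= enorm x * enorm y.
Proof.
have [->|y0] := eqVneq y 0; first by rewrite dot0r enorm0 mulr0.
have [xy0|xy0] := ltP (dot x y) 0.
  by apply: le_trans (ltW xy0) _; rewrite mulr_ge0 ?enorm_ge0.
rewrite -ler_sqr ?nnegrE ?mulr_ge0 ?enorm_ge0 // exprMn !sqr_enorm.
have := dot_ge0 (dot y y *: x - dot x y *: y).
have -> : dot (dot y y *: x - dot x y *: y) (dot y y *: x - dot x y *: y) =
    dot y y * (dot x x * dot y y - dot x y ^+ 2).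
  by rewrite !(dotBl, dotBr, dotZl, dotZr) (dotC y x); ring.
by rewrite pmulr_rge0 ?dot_gt0 // subr_ge0.
Qed.

Lemma enormD x y : enorm (x + y) <= enorm x + enorm y.
Proof.
rewrite -ler_sqr ?nnegrE ?addr_ge0 ?enorm_ge0 // sqrrD !sqr_enorm.
rewrite !(dotDl, dotDr) (dotC y x).
have := cauchy_schwarz x y; lra.
Qed.

End DotProduct.

(** * First order expansions *)

Section Expansion.
Context {R : realType} {n : nat} {W : normedModType R}.
Implicit Types (r : 'rV[R]_n -> W) (a : 'rV[R]_n).

(** An o(u - a) remainder, in the explicit form that estimates produce. *)
Definition small_at a r : Prop :=
  forall e : R, 0 < e -> \forall u \near a, `|r u| <= e * `|u - a|.

Lemma small_atD a r1 r2 :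
  small_at a r1 -> small_at a r2 -> small_at a (fun u => r1 u + r2 u).
Proof.
move=> h1 h2 e e0; have e20 : 0 < e / 2 by rewrite divr_gt0.
apply: filterS2 (h1 _ e20) (h2 _ e20) => u u1 u2.
by rewrite (le_trans (ler_normD _ _)) // [e]splitr mulrDl lerD.
Qed.

Lemma small_atN a r : small_at a r -> small_at a (fun u => - r u).
Proof. by move=> h e /h; apply: filterS => u; rewrite normrN. Qed.

Lemma small_at_eq a r1 r2 : {near a, r1 =1 r2} -> small_at a r1 -> small_at a r2.
Proof. by move=> h h1 e /h1; apply: filterS2 h => u <-. Qed.

Definition frechet (f : 'rV[R]_n -> W) a (L : 'rV[R]_n -> W) : Prop :=
  small_at a (fun u => f u - f a - L (u - a)).

Lemma linear_row_continuous (L : {linear 'rV[R]_n -> W}) : continuous L.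
Proof.
have [c EL] : exists c : 'I_n -> W, forall v, L v = \sum_i v 0 i *: c i.
  exists (fun i => L (delta_mx 0 i)) => v.
  rewrite {1}[v]row_sum_delta linear_sum; apply: eq_bigr => i _.
  by rewrite linearZ.
have -> : (L : 'rV[R]_n -> W) = fun v => \sum_i v 0 i *: c i by exact/funext.
move=> v; apply: (@cvg_big W _ +%R 0 xpredT add_continuous _ (nbhs v)) => i _.
apply: (@cvgZr_tmp R W _ (nbhs v) _ (fun w : 'rV[R]_n => w 0 i) (v 0 i) (c i)).
exact: coord_continuous.
Qed.

Lemma near_rowP a (P : 'rV[R]_n -> Prop) :
  (\forall u \near a, P u) <->
  exists2 d : R, 0 < d & forall u, `|u - a| < d -> P u.
Proof.
split=> [/nbhs_normP[d /= d0 dP]|[d d0 dP]].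
  by exists d => // u ua; apply: dP; rewrite /ball_ /= distrC.
by apply/nbhs_normP; exists d => //= u; rewrite /ball_ /= distrC => /dP.
Qed.

Lemma continuous_rowP (f : 'rV[R]_n -> W) a : {for a, continuous f} <->
  forall e : R, 0 < e -> exists2 d : R, 0 < d &
    forall u, `|u - a| < d -> `|f u - f a| <= e.
Proof.
split=> [/cvgrPdist_le h e /h /near_rowP[d d0 dP]|h].
  by exists d => // u /dP; rewrite distrC.
apply: (cvgrPdist_le (F := nbhs a) f (f a)).2 => e /h[d d0 dP].
by apply/near_rowP; exists d => // u /dP; rewrite distrC.
Qed.

(** A linear map on rows is automatically continuous, so the expansion alone
    identifies the differential. *)
Lemma frechet_is_diff f a (L : {linear 'rV[R]_n -> W}) :
  frechet f a L -> is_diff a f L.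
Proof.
move=> fL.
have cL := @linear_row_continuous L.
have fL' : f \o shift a = cst (f a) + L +o_ (0 : 'rV[R]_n) id.
  apply/eqaddoP => e e0 /=.
  have /near_rowP[d d0 dP] := fL e e0.
  apply/near_rowP; exists d => //= u; rewrite subr0 => ud.
  have := dP (u + a); rewrite addrK => /(_ ud); congr (`|_| <= _).
  by rewrite -addrA -opprD.
have dL := diff_unique cL fL'.
split=> //; apply/diff_locallyP; rewrite dL; split => //.
Qed.

Lemma is_diff_frechet f a (L : 'rV[R]_n -> W) : is_diff a f L -> frechet f a L.
Proof.
move=> [/diff_locallyP[_ h] dL] e e0; move/eqaddoP: h => /(_ e e0).
move=> /near_rowP[d d0 dP]; apply/near_rowP; exists d => // u ud.
have := dP (u - a); rewrite subr0 => /(_ ud).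
rewrite dL; congr (`|_| <= _).
by rewrite /GRing.add /= /GRing.opp /= subrK opprD addrA.
Qed.

End Expansion.

Lemma small_at_le {R : realType} {n : nat} {W W' : normedModType R} (a : 'rV[R]_n)
    (r : 'rV[R]_n -> W) (r' : 'rV[R]_n -> W') (C : R) :
  0 <= C -> (forall u, `|r' u| <= C * `|r u|) -> small_at a r -> small_at a r'.
Proof.
move=> C0 rr h e e0; have C1 : 0 < C + 1 by rewrite ltr_wpDl.
have e'0 : 0 < e / (C + 1) by rewrite divr_gt0.
apply: filterS (h _ e'0) => u ru; apply: le_trans (rr u) _.
apply: le_trans (ler_wpM2l C0 ru) _; rewrite mulrA ler_wpM2r //.
by rewrite mulrCA ler_piMr ?(ltW e0) // ler_pdivrMr // mul1r lerDl.
Qed.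

Lemma row_continuous {R : realType} {n : nat} (f : 'rV[R]_n -> 'rV[R]_n) (x : 'rV[R]_n) :
  (forall i, {for x, continuous (fun u => f u 0 i)}) -> {for x, continuous f}.
Proof.
move=> fi; apply/continuous_rowP => e e0.
have : \forall u \near x, forall i, `|f u 0 i - f x 0 i| <= e.
  apply: (@filter_forall _ _ (fun i u => `|f u 0 i - f x 0 i| <= e) (nbhs x)) => i.
  by have /continuous_rowP/(_ e e0)[d d0 dP] := fi i; apply/near_rowP; exists d.
move=> /near_rowP[d d0 dP]; exists d => // u ud.
by apply: norm_le_entries => [|i]; [exact: ltW|rewrite !mxE; exact: dP].
Qed.

Lemma open_row_ball {R : realType} {n : nat} (a : 'rV[R]_n) (d : R) :
  open [set u : 'rV[R]_n | `|u - a| < d].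
Proof.
rewrite openE => x /= xa; apply/near_rowP.
exists (d - `|x - a|) => [|u]; first by rewrite subr_gt0.
by rewrite ltrBrDr => ux; rewrite /= -[u](subrK x) -addrA (le_lt_trans (ler_normD _ _)).
Qed.

Section StrictDifferentiability.
Context {R : realType} {n : nat}.
Implicit Types (f : 'rV[R]_n -> R) (a g u v w : 'rV[R]_n).

(** Strict differentiability: both points vary. This controls chords of the level
    sets of [f] near [a] and yields local Lipschitz bounds. *)
Definition strict_grad f a g : Prop :=
  forall e : R, 0 < e -> exists2 d : R, 0 < d &
    forall u v, `|u - a| < d -> `|v - a| < d ->
    `|f u - f v - dot (u - v) g| <= e * `|u - v|.

Lemma is_derive_line f w v (t : R) :
  derivable f (w + t *: v) v ->
  is_derive t 1 (fun s : R => f (w + s *: v)) ('D_v f (w + t *: v)).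
Proof.
move=> df; have E : (fun h : R => h^-1 *: (f (h *: v + (w + t *: v)) - f (w + t *: v)))
   = (fun h : R => h^-1 *: (f (w + (h%:A + t) *: v) - f (w + t *: v))).
  apply/funext => h; congr (_ *: (f _ - _)).
  by rewrite [_%:A]mulr1 scalerDl addrCA.
split; last by rewrite /derive E.
by move: df; rewrite /derivable E.
Qed.

Lemma mvt_line f w v :
  (forall s : R, 0 <= s <= 1 -> derivable f (w + s *: v) v) ->
  exists2 s : R, 0 <= s <= 1 & f (w + v) - f w = 'D_v f (w + s *: v).
Proof.
move=> df.
have df' (s : R) : s \in `[0, 1]%R ->
    is_derive s 1 (fun s : R => f (w + s *: v)) ('D_v f (w + s *: v)).
  by rewrite in_itv /= => /df /is_derive_line.
have d01 (s : R) : s \in `]0, 1[%R ->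
    is_derive s 1 (fun s : R => f (w + s *: v)) ('D_v f (w + s *: v)).
  by move=> s01; apply: df'; exact: subset_itv_oo_cc s01.
have c01 : {within `[0, 1], continuous (fun s : R => f (w + s *: v))}.
  apply: derivable_within_continuous => s s01.
  exact: (@ex_derive _ _ _ _ _ _ _ (df' s s01)).
have [s] := MVT_segment ler01 d01 c01.
rewrite in_itv /= => s01; rewrite scale1r scale0r addr0 subr0 mulr1 => E.
by exists s.
Qed.

Lemma is_derive_from_line f w v (l : R) :
  is_derive (0 : R) 1 (fun s : R => f (w + s *: v)) l -> is_derive w v f l.
Proof.
move=> h1.
have E : (fun h : R => h^-1 *: (f (w + (h%:A + 0) *: v) - f (w + 0 *: v))) =
    (fun h : R => h^-1 *: (f (h *: v + w) - f w)).
  apply/funext => h; rewrite [_%:A]mulr1 addr0 scale0r addr0.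
  by rewrite [w + _]addrC.
have [d1 d2] := h1; split.
  by move: d1; rewrite /derivable E.
by move: d2; rewrite /derive E.
Qed.

Lemma derivable_scaled f w v (t : R) : derivable f w v ->
  derivable f w (t *: v) /\ 'D_(t *: v) f w = t * 'D_v f w.
Proof.
have [->|t0] := eqVneq t 0.
  by rewrite scale0r mul0r derive0; split => //; exact: derivable0.
move=> df.
have h0 : is_derive (0 : R) 1 (fun s : R => f (w + s *: v)) ('D_v f w).
  by have := @is_derive_line f w v 0; rewrite scale0r addr0; apply.
have h1 : is_derive (0 : R) 1 (fun s : R => f (w + s *: (t *: v))) (t * 'D_v f w).
  have -> : (fun s : R => f (w + s *: (t *: v))) =
      (fun s : R => f (w + s *: v)) \o (fun s => s * t).
    by apply/funext => s /=; rewrite scalerA.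
  rewrite mulrC; apply: is_derive1_comp; first by rewrite mul0r.
  have := is_deriveM (is_derive_id (0 : R) (1 : R)) (is_derive_cst t (0 : R) (1 : R)).
  by rewrite scaler0 add0r /cst [_%:A]mulr1.
have [d1 d2] := is_derive_from_line h1; by split.
Qed.

(** Going from [v] to [u] one coordinate at a time, the mean value theorem turns each
    step into a partial derivative at a point near [a]. *)
Lemma strict_grad_of_partials f a :
  (\forall x \near a, forall i, derivable f x (delta_mx 0 i)) ->
  (forall i, {for a, continuous (fun x => 'D_(delta_mx 0 i) f x)}) ->
  strict_grad f a (grad f a).
Proof.
move=> df cf e e0.
have e'0 : 0 < e / n.+1%:R by rewrite divr_gt0.
have : \forall x \near a, forall i, derivable f x (delta_mx 0 i) /\
    `|grad f a 0 i - 'D_(delta_mx 0 i) f x| <= e / n.+1%:R.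
  apply: (@filter_forall _ _ (fun i x => derivable f x (delta_mx 0 i) /\
    `|grad f a 0 i - 'D_(delta_mx 0 i) f x| <= e / n.+1%:R) (nbhs a)) => i.
  have /cvgrPdist_le/(_ _ e'0) cfi := cf i.
  by apply: filterS2 df cfi => x dx h; split; [exact: dx|rewrite mxE; exact: h].
move=> /near_rowP[d d0 dP]; exists d => // u v ud vd.
(* The path changes the coordinates from [v] to [u] one by one; it stays in the sup
   norm ball around [a]. *)
pose w k : 'rV[R]_n := \row_(j < n) if (j < k)%N then u 0 j else v 0 j.
have w0 : w 0%N = v by apply/rowP => j; rewrite mxE.
have wn : w n = u by apply/rowP => j; rewrite mxE ltn_ord.
have wS (i : 'I_n) : w i.+1 = w i + (u 0 i - v 0 i) *: delta_mx 0 i.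
  apply/rowP => j; rewrite !mxE eqxx ltnS leq_eqVlt (inj_eq val_inj) /=.
  have [->|_] := eqVneq j i; last by rewrite mulr0 addr0.
  by rewrite ltnn mulr1 addrC subrK.
have wd (i : 'I_n) (s : R) : 0 <= s <= 1 ->
    `|w i + s *: ((u 0 i - v 0 i) *: delta_mx 0 i) - a| < d.
  move=> /andP[s0 s1].
  apply: (@le_lt_trans _ _ (Num.max `|u - a| `|v - a|)); last by rewrite gt_max ud vd.
  apply: norm_le_entries => [|j]; first by rewrite le_max normr_ge0.
  have uj : `|u 0 j - a 0 j| <= Num.max `|u - a| `|v - a|.
    by rewrite le_max; apply/orP; left; have := entry_le_norm (u - a) j; rewrite !mxE.
  have vj : `|v 0 j - a 0 j| <= Num.max `|u - a| `|v - a|.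
    by rewrite le_max; apply/orP; right; have := entry_le_norm (v - a) j; rewrite !mxE.
  rewrite !mxE eqxx /=.
  have [ji|_] := eqVneq j i; last by rewrite !mulr0 addr0; case: ifP.
  rewrite ji ltnn mulr1 -ji.
  have -> : v 0 j + s * (u 0 j - v 0 j) - a 0 j =
    (1 - s) * (v 0 j - a 0 j) + s * (u 0 j - a 0 j) by ring.
  rewrite (le_trans (ler_normD _ _)) // !normrM (ger0_norm s0).
  rewrite ger0_norm ?subr_ge0 // -[leRHS]mul1r -[X in X * Num.max _ _](subrK s).
  by rewrite [leRHS]mulrDl lerD // ler_wpM2l // subr_ge0.
rewrite -w0 -{1}wn -(telescope_sumr (fun k => f (w k))) // big_mkord.
rewrite dotE -sumrB (le_trans (ler_norm_sum _ _ _)) //.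
have -> : e * `|u - w 0%N| = n.+1%:R * (e / n.+1%:R * `|u - v|).
  by rewrite mulrA [n.+1%:R * _]mulrC divfK // w0.
apply: (@le_trans _ _ (\sum_(i < n) (e / n.+1%:R * `|u - v|))); last first.
  rewrite sumr_const card_ord -[leLHS]mulr_natl ler_wpM2r ?ler_nat //.
  by rewrite mulr_ge0 // ltW.
apply: ler_sum => i _; rewrite wS.
have [s s01|s s01 ->] := @mvt_line f (w i) ((u 0 i - v 0 i) *: delta_mx 0 i).
  exact: (derivable_scaled _ (dP _ (wd i s s01) i).1).1.
have [h1 h2] := dP _ (wd i s s01) i.
rewrite (derivable_scaled _ h1).2 w0 !mxE -mulrBr normrM mulrC.
by rewrite ler_pM //; [rewrite distrC; move: h2; rewrite mxE|
  have := entry_le_norm (u - v) i; rewrite !mxE].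
Qed.

End StrictDifferentiability.

Section Gradient.
Context {R : realType} {n : nat}.
Implicit Types (f : 'rV[R]_n -> R) (a g u v w : 'rV[R]_n).

Lemma strict_grad_frechet f a g : strict_grad f a g -> frechet f a (dot^~ g).
Proof.
move=> h e e0; have [d d0 dP] := h e e0; apply/near_rowP; exists d => // u ud.
by apply: dP => //; rewrite subrr normr0.
Qed.

Lemma frechet_dot_is_diff f a g : frechet f a (dot^~ g) -> is_diff a f (dot^~ g).
Proof.
have lin : linear (fun v => dot v g : R^o).
  by move=> c u v; rewrite dotDl dotZl.
pose lM := GRing.isLinear.Build _ _ _ _ (fun v => dot v g : R^o) lin.
pose L : {linear 'rV[R]_n -> R^o} := HB.pack (fun v => dot v g : R^o) lM.
exact: (@frechet_is_diff _ _ _ f a L).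
Qed.

Lemma frechet_grad f a g : frechet f a (dot^~ g) -> grad f a = g.
Proof.
move=> /frechet_dot_is_diff [df dE]; apply/rowP => i.
by rewrite mxE deriveE // dE dot_delta.
Qed.

Lemma derive_grad f a v : differentiable f a -> 'D_v f a = dot v (grad f a).
Proof.
move=> df; rewrite deriveE // {1}[v]row_sum_delta linear_sum dotE.
by apply: eq_bigr => i _; rewrite linearZ /= mxE deriveE.
Qed.

Lemma strict_grad_lip f a g : strict_grad f a g ->
  exists2 L : R, 0 < L & exists2 d : R, 0 < d &
  forall u v, `|u - a| < d -> `|v - a| < d -> `|f u - f v| <= L * `|u - v|.
Proof.
move=> /(_ 1 ltr01)[d d0 dP]; exists (1 + n%:R * `|g|).
  by rewrite ltr_pwDl // mulr_ge0.
exists d => // u v ud vd; rewrite -(subrK (dot (u - v) g) (f u - f v)).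
rewrite (le_trans (ler_normD _ _)) // mulrDl lerD ?dP //.
by rewrite (le_trans (norm_dot_le _ _)) // mulrAC.
Qed.

Lemma is_diff_dot (e x : 'rV[R]_n) : is_diff x (fun x => dot x e) (dot^~ e).
Proof.
apply: frechet_dot_is_diff => d d0; apply/near_rowP; exists 1 => // u _.
by rewrite dotBl subrr normr0 mulr_ge0 // ltW.
Qed.

End Gradient.

(** * The classes of functions with Hoelder derivatives *)

Section HoelderClasses.
Context {R : realType} {n : nat} {W : normedModType R}.
Implicit Types (f g : 'rV[R]_n -> W) (A : set 'rV[R]_n) (alpha : R).

Lemma holder_onP alpha f A : holder_on alpha f A <->
  forall x, A x -> exists2 C : R, 0 <= C & exists2 d : R, 0 < d &
  forall u v, `|u - x| < d -> `|v - x| < d ->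
    `|f u - f v| <= C * `|u - v| `^ alpha.
Proof.
split=> h x /h.
  move=> [C [[Q1 Q2] /= [/near_rowP[d1 d10 h1] /near_rowP[d2 d20 h2]] hQ]].
  exists `|C| => //; exists (Num.min d1 d2); first by rewrite lt_min d10.
  move=> u v; rewrite !lt_min => /andP[u1 u2] /andP[v1 v2].
  apply: le_trans (hQ (u, v) _) _; first by split => /=; [exact: h1|exact: h2].
  by rewrite ler_wpM2r ?powR_ge0 // ler_norm.
move=> [C C0 [d d0 dP]]; exists C.
exists ([set u | `|u - x| < d], [set u | `|u - x| < d]) => /=.
  by split; apply/near_rowP; exists d.
by move=> [u v] /= []; exact: dP.
Qed.

Lemma Ckalpha_continuous k alpha f A x :
  Ckalpha k alpha f A -> A x -> {for x, continuous f}.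
Proof. by case: k => [|k] [h _]; exact: h. Qed.

Lemma Ckalpha_subset k alpha f A B :
  B `<=` A -> Ckalpha k alpha f A -> Ckalpha k alpha f B.
Proof.
move=> BA; elim: k f => [|k ih] f [cf h]; (split; first by move=> x /BA/cf).
  by move=> x /BA/h.
by move=> i; have [h1 h2] := h i; split=> [x /BA/h1//|]; exact: ih.
Qed.

Lemma open_near_eq {T : Type} A (f g : 'rV[R]_n -> T) x : open A -> {in A, f =1 g} -> A x ->
  \forall y \near x, f y = g y.
Proof.
move=> oA fg Ax; have : nbhs x A by exact: open_nbhs_nbhs.
by apply: filterS => y Ay; apply: fg; rewrite inE.
Qed.

Lemma Ckalpha_eq k alpha f g A : open A -> {in A, f =1 g} ->
  Ckalpha k alpha f A -> Ckalpha k alpha g A.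
Proof.
move=> oA; elim: k f g => [|k ih] f g fg [cf h].
  split.
    move=> x Ax; have fgx := open_near_eq oA fg Ax.
    have : g y @[y --> x] --> f x by exact: cvg_trans (near_eq_cvg fgx) (cf x Ax).
    by rewrite (nbhs_singleton fgx).
  apply/holder_onP => x Ax; have [C C0 [d d0 dP]] := (holder_onP _ _ _).1 h x Ax.
  have /near_rowP[d' d'0 fgx] := open_near_eq oA fg Ax.
  exists C => //; exists (Num.min d d'); first by rewrite lt_min d0.
  move=> u v; rewrite !lt_min => /andP[u1 u2] /andP[v1 v2].
  by rewrite -!fgx //; exact: dP.
split.
  move=> x Ax; have fgx := open_near_eq oA fg Ax.
  have : g y @[y --> x] --> f x by exact: cvg_trans (near_eq_cvg fgx) (cf x Ax).
  by rewrite (nbhs_singleton fgx).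
move=> i; have [h1 h2] := h i; split=> [x Ax|].
  by apply: near_eq_derivable (h1 x Ax); exact: open_near_eq fg Ax.
apply: ih h2 => x; rewrite inE => Ax.
by apply: near_eq_derive; exact: open_near_eq fg Ax.
Qed.

Lemma Ckalpha_cst k alpha (c : W) A : open A -> Ckalpha k alpha (fun _ => c) A.
Proof.
move=> oA; elim: k c => [|k ih] c; (split; first by move=> x _; exact: cst_continuous).
- apply/holder_onP => x _; exists 0 => //; exists 1 => // u v _ _.
  by rewrite subrr normr0 mul0r.
- move=> i; split=> [x _|]; first exact: derivable_cst.
  apply: Ckalpha_eq (ih 0) => // x xA; rewrite [RHS]derive_cst //.
Qed.

Lemma CkalphaD k alpha f g A : open A -> Ckalpha k alpha f A ->
  Ckalpha k alpha g A -> Ckalpha k alpha (fun x => f x + g x) A.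
Proof.
move=> oA; elim: k f g => [|k ih] f g [cf hf] [cg hg].
  split; first by move=> x Ax; exact: (cvgD (cf x Ax) (cg x Ax)).
  apply/holder_onP => x Ax.
  have [C C0 [d d0 dP]] := (holder_onP _ _ _).1 hf x Ax.
  have [C' C'0 [d' d'0 dP']] := (holder_onP _ _ _).1 hg x Ax.
  exists (C + C'); first exact: addr_ge0.
  exists (Num.min d d'); first by rewrite lt_min d0.
  move=> u v; rewrite !lt_min => /andP[u1 u2] /andP[v1 v2].
  rewrite opprD addrACA (le_trans (ler_normD _ _)) // mulrDl lerD //.
    exact: dP.
  exact: dP'.
split; first by move=> x Ax; exact: (cvgD (cf x Ax) (cg x Ax)).
move=> i; have [f1 f2] := hf i; have [g1 g2] := hg i; split=> [x Ax|].
  exact: (derivableD (f1 x Ax) (g1 x Ax)).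
apply: Ckalpha_eq (ih _ _ f2 g2) => // x; rewrite inE => Ax.
exact: (esym (deriveD (f1 x Ax) (g1 x Ax))).
Qed.

End HoelderClasses.

Lemma is_deriveZl {R : realType} {V W : normedModType R} (f : V -> R) (w : W)
    (a v : V) (l : R) :
  is_derive a v f l -> is_derive a v (fun x => f x *: w) (l *: w).
Proof.
move=> [df dl].
have E : (fun h : R => h^-1 *: (f (h *: v + a) *: w - f a *: w)) =
    (fun h : R => (h^-1 *: (f (h *: v + a) - f a)) *: w).
  by apply/funext => h; rewrite -scalerBl scalerA.
have c : (fun h : R => h^-1 *: (f (h *: v + a) *: w - f a *: w)) @ 0^' --> l *: w.
  by rewrite E -dl; apply: (@cvgZr_tmp _ _ _ 0^' _ _ _ w df).
split; first by apply/cvg_ex; exists (l *: w).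
exact: cvg_lim c.
Qed.

Section HoelderAlgebra.
Context {R : realType} {n : nat}.
Implicit Types (f g : 'rV[R]_n -> R) (A : set 'rV[R]_n) (alpha : R).

Lemma CkalphaZl {W : normedModType R} k alpha (f : 'rV[R]_n -> R) (w : W) A : open A ->
  Ckalpha k alpha f A -> Ckalpha k alpha (fun x => f x *: w) A.
Proof.
move=> oA; elim: k f => [|k ih] f [cf hf].
  split; first by move=> x Ax; exact: (@cvgZr_tmp _ _ _ (nbhs x) _ f (f x) w (cf x Ax)).
  apply/holder_onP => x Ax.
  have [C C0 [d d0 dP]] := (holder_onP _ _ _).1 hf x Ax.
  exists (C * `|w|); first exact: mulr_ge0.
  exists d => // u v ud vd.
  by rewrite -scalerBl normrZ mulrAC ler_wpM2r // dP.
split; first by move=> x Ax; exact: (@cvgZr_tmp _ _ _ (nbhs x) _ f (f x) w (cf x Ax)).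
move=> i; have [f1 f2] := hf i.
have D x : A x -> is_derive x (delta_mx 0 i : 'rV[R]_n) (fun x => f x *: w)
    ('D_(delta_mx 0 i) f x *: w).
  by move=> Ax; apply: is_deriveZl; apply/derivableP; exact: f1.
split=> [x Ax|].
  by have [] := D x Ax.
apply: Ckalpha_eq (ih _ f2) => // x; rewrite inE => Ax.
by have [_ ->] := D x Ax.
Qed.


Lemma CkalphaN k alpha f A : open A ->
  Ckalpha k alpha f A -> Ckalpha k alpha (fun x => - f x) A.
Proof.
move=> oA /(CkalphaZl (-1 : R^o) oA); apply: Ckalpha_eq => // x _.
exact: mulrN1.
Qed.

Lemma powR_ge_id (x alpha : R) : 0 <= x <= 1 -> alpha <= 1 -> x <= x `^ alpha.
Proof.
move=> /andP[x0 x1] a1; have [->|xn0] := eqVneq x 0; first exact: powR_ge0.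
have xp : 0 < x by rewrite lt_neqAle eq_sym xn0.
rewrite -{1}(powRr1 x0); apply: ger_powR => //; exact/andP.
Qed.

Lemma lipschitz_holder {W : normedModType R} alpha (f : 'rV[R]_n -> W) A :
  alpha <= 1 ->
  (forall x, A x -> exists2 C : R, 0 <= C & exists2 d : R, 0 < d &
    forall u v, `|u - x| < d -> `|v - x| < d -> `|f u - f v| <= C * `|u - v|) ->
  holder_on alpha f A.
Proof.
move=> a1 h; apply/holder_onP => x /h[C C0 [d d0 dP]]; exists C => //.
exists (Num.min d (1 / 2)); first by rewrite lt_min d0 divr_gt0.
move=> u v; rewrite !lt_min => /andP[u1 u2] /andP[v1 v2].
apply: le_trans (dP _ _ u1 v1) _; rewrite ler_wpM2l // powR_ge_id //.
rewrite normr_ge0 /= -(subrK x u) -addrA (le_trans (ler_normD _ _)) //.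
by rewrite (distrC x) [leRHS]splitr lerD // ltW.
Qed.

Lemma Ckalpha_strict_grad k alpha f A x : open A -> Ckalpha k.+1 alpha f A -> A x ->
  strict_grad f x (grad f x).
Proof.
move=> oA [cf hf] Ax; apply: strict_grad_of_partials => [|i].
  have : nbhs x A by exact: open_nbhs_nbhs.
  by apply: filterS => y Ay i; exact: (hf i).1.
exact: Ckalpha_continuous (hf i).2 Ax.
Qed.

Lemma Ckalpha_differentiable k alpha f A x : open A -> Ckalpha k.+1 alpha f A ->
  A x -> differentiable f x.
Proof.
move=> oA fA Ax; have := Ckalpha_strict_grad oA fA Ax.
by move=> /strict_grad_frechet/frechet_dot_is_diff[].
Qed.

(** Continuous partial derivatives make a function locally Lipschitz, hence Hoelder
    for every exponent up to 1. *)
Lemma Ckalpha_le k alpha f A : open A -> alpha <= 1 ->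
  Ckalpha k.+1 alpha f A -> Ckalpha k alpha f A.
Proof.
move=> oA a1; elim: k f => [|k ih] f fA.
  split; first by move=> x; exact: Ckalpha_continuous fA.
  apply: lipschitz_holder => // x Ax.
  have [L L0 h] := strict_grad_lip (Ckalpha_strict_grad oA fA Ax).
  by exists L => //; exact: ltW.
have [cf hf] := fA; split => // i; have [h1 h2] := hf i.
by split => //; exact: ih.
Qed.

Lemma Ckalpha_geq j k alpha (f : 'rV[R]_n -> R) A : open A -> alpha <= 1 ->
  (j <= k)%N -> Ckalpha k alpha f A -> Ckalpha j alpha f A.
Proof.
move=> oA a1; elim: k => [|k ih]; first by rewrite leqn0 => /eqP ->.
rewrite leq_eqVlt ltnS => /orP[/eqP -> //|/ih h fk].
by apply: h; exact: Ckalpha_le.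
Qed.

Lemma Ckalpha_bounded k alpha f A x : Ckalpha k alpha f A -> A x ->
  exists2 d : R, 0 < d & forall u, `|u - x| < d -> `|f u| <= `|f x| + 1.
Proof.
move=> fA Ax; have := Ckalpha_continuous fA Ax.
move=> /continuous_rowP/(_ 1 ltr01)[d d0 dP]; exists d => // u /dP h.
by rewrite -[f u](subrK (f x)) addrC (le_trans (ler_normD _ _)) // lerD2l.
Qed.

(** By Leibniz' rule; the factor that is not differentiated has one order of
    regularity to spare. *)
Lemma CkalphaM k alpha f g A : open A -> alpha <= 1 -> Ckalpha k alpha f A ->
  Ckalpha k alpha g A -> Ckalpha k alpha (fun x => f x * g x) A.
Proof.
move=> oA a1; elim: k f g => [|k ih] f g fA gA; (have [cf hf] := fA); (have [cg hg] := gA).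
  split; first by move=> x Ax; exact: (cvgM (cf x Ax) (cg x Ax)).
  apply/holder_onP => x Ax.
  have [C C0 [d d0 dP]] := (holder_onP _ _ _).1 hf x Ax.
  have [C' C'0 [d' d'0 dP']] := (holder_onP _ _ _).1 hg x Ax.
  have [d1 d10 dP1] := Ckalpha_bounded fA Ax.
  have [d2 d20 dP2] := Ckalpha_bounded gA Ax.
  exists ((`|f x| + 1) * C' + (`|g x| + 1) * C).
    by rewrite addr_ge0 // mulr_ge0 // addr_ge0.
  exists (Num.min (Num.min d d') (Num.min d1 d2)).
    by rewrite !lt_min d0 d'0 d10.
  move=> u v; rewrite !lt_min => /andP[/andP[u1 u2] /andP[u3 u4]].
  move=> /andP[/andP[v1 v2] /andP[v3 v4]].
  have -> : f u * g u - f v * g v = f u * (g u - g v) + g v * (f u - f v) by ring.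
  rewrite (le_trans (ler_normD _ _)) // !normrM mulrDl -!mulrA.
  by rewrite lerD // ler_pM // ?dP1 ?dP' ?dP2 ?dP.
split; first by move=> x Ax; exact: (cvgM (cf x Ax) (cg x Ax)).
move=> i; have [f1 f2] := hf i; have [g1 g2] := hg i; split=> [x Ax|].
  exact: (derivableM (f1 x Ax) (g1 x Ax)).
have fk := Ckalpha_le oA a1 fA; have gk := Ckalpha_le oA a1 gA.
apply: Ckalpha_eq (CkalphaD oA (ih _ _ fk g2) (ih _ _ gk f2)) => // x.
by rewrite inE => Ax; exact: (esym (deriveM (f1 x Ax) (g1 x Ax))).
Qed.

Lemma Ckalpha_sum k alpha (I : Type) (s : seq I) (f : I -> 'rV[R]_n -> R) A : open A ->
  (forall i, Ckalpha k alpha (f i) A) -> Ckalpha k alpha (fun x => \sum_(i <- s) f i x) A.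
Proof.
move=> oA fA; elim: s => [|i s ih].
  by apply: Ckalpha_eq (Ckalpha_cst _ _ 0 oA) => // x _; rewrite big_nil.
by apply: Ckalpha_eq (CkalphaD oA (fA i) ih) => // x _; rewrite big_cons.
Qed.

(** The order 0 case for reciprocals and square roots. *)
Lemma C0alpha_comp alpha (h : R -> R) f A :
  (forall x, A x -> exists2 L : R, 0 <= L & exists2 d : R, 0 < d &
    forall s t, `|s - f x| < d -> `|t - f x| < d -> `|h s - h t| <= L * `|s - t|) ->
  Ckalpha 0 alpha f A -> Ckalpha 0 alpha (h \o f) A.
Proof.
move=> hL [cf hf]; split.
  move=> x Ax; have [L L0 [d d0 dP]] := hL x Ax.
  apply/continuous_rowP => e e0.
  have e'0 : 0 < Num.min (d / 2) (e / (L + 1)).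
    by rewrite lt_min !divr_gt0 // ltr_wpDl.
  have /continuous_rowP/(_ _ e'0)[d' d'0 dP'] := cf x Ax.
  exists d' => // u /dP'; rewrite le_min => /andP[u1 u2] /=.
  rewrite (le_trans (dP _ _ _ _)) ?subrr ?normr0 //.
    by rewrite (le_lt_trans u1) // ltr_pdivrMr // ltr_pMr // ltr1n.
  rewrite (le_trans (ler_wpM2l L0 u2)) // mulrCA ler_piMr ?(ltW e0) //.
  by rewrite ler_pdivrMr ?mul1r ?lerDl // ltr_wpDl.
apply/holder_onP => x Ax; have [L L0 [d d0 dP]] := hL x Ax.
have [C C0 [d' d'0 dP']] := (holder_onP _ _ _).1 hf x Ax.
have d20 : 0 < d / 2 by rewrite divr_gt0.
have /continuous_rowP/(_ _ d20)[d1 d10 dP1] := cf x Ax.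
exists (L * C); first exact: mulr_ge0.
exists (Num.min d' d1); first by rewrite lt_min d'0.
move=> u v; rewrite !lt_min => /andP[u1 u2] /andP[v1 v2].
have dd w : `|w - x| < d1 -> `|f w - f x| < d.
  move=> /dP1 /le_lt_trans; apply.
  by rewrite ltr_pdivrMr // ltr_pMr // ltr1n.
rewrite (le_trans (dP _ _ (dd _ u2) (dd _ v2))) // -mulrA ler_wpM2l //.
exact: dP'.
Qed.

Lemma CkalphaV k alpha f A : open A -> alpha <= 1 -> (forall x, A x -> f x != 0) ->
  Ckalpha k alpha f A -> Ckalpha k alpha (fun x => (f x)^-1) A.
Proof.
move=> oA a1; elim: k f => [|k ih] f f0 fA.
  apply: (C0alpha_comp (h := @GRing.inv R)) fA => x /f0 fx.
  have p : 0 < `|f x| by rewrite normr_gt0.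
  exists ((`|f x| / 2) ^+ 2)^-1; first by rewrite invr_ge0 sqr_ge0.
  exists (`|f x| / 2) => [|s t hs ht]; first by rewrite divr_gt0.
  have far w : `|w - f x| < `|f x| / 2 -> `|f x| / 2 <= `|w|.
    move=> hw; have := ler_normB w (w - f x); rewrite opprB addrC subrK.
    by move: hw p; lra.
  have p2 : 0 < `|f x| / 2 by rewrite divr_gt0.
  have s0 : s != 0 by rewrite -normr_gt0 (lt_le_trans p2) // far.
  have t0 : t != 0 by rewrite -normr_gt0 (lt_le_trans p2) // far.
  have -> : s^-1 - t^-1 = (t - s) / (s * t) by field; rewrite ?s0 ?t0.
  rewrite normrM normfV [leLHS]mulrC (distrC t); apply: ler_wpM2r => //.
  have st : (`|f x| / 2) ^+ 2 <= `|s * t|.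
    by rewrite normrM expr2 ler_pM ?(ltW p2) // far.
  by rewrite lef_pV2 // posrE ?exprn_gt0 // (lt_le_trans _ st) // exprn_gt0.
have [cf hf] := fA; have fk := Ckalpha_le oA a1 fA.
split.
  by move=> x Ax; exact: (cvgV (f0 x Ax) (cf x Ax)).
move=> i; have [f1 f2] := hf i; split=> [x Ax|].
  exact: (derivableV (f0 x Ax) (f1 x Ax)).
have ik := ih _ f0 fk.
apply: Ckalpha_eq (CkalphaN oA (CkalphaM oA a1 (CkalphaM oA a1 ik ik) f2)) => // x.
rewrite inE => Ax; apply: (etrans _ (esym (deriveV (f0 x Ax) (f1 x Ax)))).
by rewrite -exprVn expr2 scaleNr.
Qed.

Lemma Ckalpha_sqrt k alpha f A : open A -> alpha <= 1 -> (forall x, A x -> 0 < f x) ->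
  Ckalpha k alpha f A -> Ckalpha k alpha (fun x => Num.sqrt (f x)) A.
Proof.
move=> oA a1; elim: k f => [|k ih] f f0 fA.
  apply: (C0alpha_comp (h := @Num.sqrt R)) fA => x /f0 fx.
  have p : 0 < Num.sqrt (f x / 2) by rewrite sqrtr_gt0 divr_gt0.
  exists (Num.sqrt (f x / 2))^-1; first by rewrite invr_ge0 ltW.
  exists (f x / 2) => [|s t hs ht]; first by rewrite divr_gt0.
  have far w : `|w - f x| < f x / 2 -> f x / 2 <= w.
    by rewrite ltr_norml => /andP[]; lra.
  have s0 : 0 <= s by rewrite (le_trans _ (far _ hs)) // divr_ge0 // ltW.
  have t0 : 0 <= t by rewrite (le_trans _ (far _ ht)) // divr_ge0 // ltW.
  have {1}<- : (Num.sqrt s - Num.sqrt t) * (Num.sqrt s + Num.sqrt t) = s - t.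
    by rewrite -subr_sqr !sqr_sqrtr.
  rewrite normrM [leRHS]mulrC ler_pdivlMr // ler_wpM2l // ger0_norm ?addr_ge0 ?sqrtr_ge0 //.
  by rewrite ler_wpDr ?sqrtr_ge0 // ler_wsqrtr // far.
have [cf hf] := fA; have fk := Ckalpha_le oA a1 fA.
have sk := ih _ f0 fk.
split.
  by move=> x Ax; apply: continuous_comp (cf x Ax) _; exact: sqrt_continuous.
have D i x : A x -> is_derive x (delta_mx 0 i : 'rV[R]_n) (fun x => Num.sqrt (f x))
    ((2 * Num.sqrt (f x))^-1 * 'D_(delta_mx 0 i) f x).
  move=> Ax; apply: is_derive_from_line.
  apply: (@is_derive1_comp _ (@Num.sqrt R)).
    by rewrite scale0r addr0; apply: is_derive1_sqrt; exact: f0.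
  have := @is_derive_line _ _ f x (delta_mx 0 i) 0.
  by rewrite scale0r addr0; apply; exact: (hf i).1.
move=> i; have [f1 f2] := hf i; split=> [x Ax|].
  by have [] := D i x Ax.
have c2 := CkalphaM oA a1 (Ckalpha_cst k alpha (2 : R) oA) sk.
have n0 x : A x -> 2 * Num.sqrt (f x) != 0.
  by move=> /f0 fx; rewrite mulf_neq0 // gt_eqF // sqrtr_gt0.
apply: Ckalpha_eq (CkalphaM oA a1 (CkalphaV oA a1 n0 c2) f2) => // x.
by rewrite inE => Ax; have [_ ->] := D i x Ax.
Qed.

End HoelderAlgebra.

(** * Distances to the boundary *)

Section Boundary.
Context {R : realType} {n : nat}.
Implicit Types (U : set 'rV[R]_n) (x y : 'rV[R]_n).

Lemma boundary_not_open U y : open U -> boundary U y -> ~ U y.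
Proof. by move=> /interior_id oU [_]; rewrite oU. Qed.

Lemma boundaryP U y : open U -> boundary U y <->
  ~ U y /\ forall d : R, 0 < d -> exists2 u, U u & `|u - y| < d.
Proof.
move=> /interior_id oU; rewrite /boundary oU; split=> [[cy nUy]|[nUy h]].
  split=> // d d0; have [|u [Uu ud]] := cy [set u | `|u - y| < d].
    by apply/near_rowP; exists d.
  by exists u.
split=> // B /near_rowP[d d0 dP]; have [u Uu ud] := h d d0.
by exists u; split => //; exact: dP.
Qed.

Lemma boundary_compact U : bounded_set U -> compact (boundary U).
Proof.
move=> [M [Mreal hM]]; apply: bounded_closed_compact.
  exists (M + 1); split; first by rewrite realD.
  move=> N MN y [cy _]; apply/ler_addgt0Pl => e e0.
  have [|u [Uu ud]] := cy [set u | `|u - y| < e].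
    by apply/near_rowP; exists e.
  rewrite -[y](subrK u) (le_trans (ler_normD _ _)) // lerD //.
    by rewrite distrC ltW.
  by apply: hM => //; apply: lt_trans MN; rewrite ltrDl.
apply: closedI; first exact: closed_closure.
by apply: open_closedC; exact: open_interior.
Qed.

End Boundary.

Section Distance.
Context {R : realType} {n : nat}.
Variables (q : 'rV[R]_n -> R) (C : R) (Z : set 'rV[R]_n).
Implicit Types (x y : 'rV[R]_n).
Hypothesis q_ge0 : forall x, 0 <= q x.
Hypothesis C_ge0 : 0 <= C.
Hypothesis q_lip : forall x y, q x <= q y + C * `|x - y|.
Hypothesis Z_compact : compact Z.
Hypothesis Z_nonempty : Z !=set0.

(** The distance to [Z] when the displacement [x - y] costs [q (x - y)]: the gauge
    distance and the Euclidean distance are both of this kind. *)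
Definition qdist x := inf [set q (x - y) | y in Z].

Lemma qdist_le x y : Z y -> qdist x <= q (x - y).
Proof.
move=> Zy; apply: ge_inf; last by exists y.
by exists 0 => _ [z _ <-]; exact: q_ge0.
Qed.

Lemma qdist_ge0 x : 0 <= qdist x.
Proof.
apply: lb_le_inf; last by move=> _ [z _ <-]; exact: q_ge0.
by have [y Zy] := Z_nonempty; exists (q (x - y)), y.
Qed.

Lemma q_sub_continuous x : continuous (fun y : 'rV[R]_n => q (x - y)).
Proof.
move=> y; apply/continuous_rowP => e e0; have C1 : 0 < C + 1 by rewrite ltr_wpDl.
exists (e / (C + 1)) => [|u ud]; first by rewrite divr_gt0.
have b : C * `|u - y| <= e.
  apply: le_trans (ler_wpM2l C_ge0 (ltW ud)) _.
  by rewrite mulrCA ler_piMr ?(ltW e0) // ler_pdivrMr // mul1r lerDl.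
have := q_lip (x - u) (x - y); have := q_lip (x - y) (x - u).
have E a c : (x - a) - (x - c) = c - a by rewrite [x - a]addrC addrKA opprK addrC.
rewrite !E (distrC y) ler_norml.
by move: b; lra.
Qed.

Lemma qdist_attained x : exists2 y, Z y & qdist x = q (x - y).
Proof.
have [|y + hy] := EVT_min_rV Z_nonempty Z_compact (f := fun y => q (x - y)).
  by apply: continuous_subspaceT; exact: q_sub_continuous.
rewrite inE => Zy; exists y => //; apply/eqP; rewrite eq_le qdist_le //=.
apply: lb_le_inf; first by exists (q (x - y)), y.
by move=> _ [z Zz <-]; apply: hy; rewrite inE.
Qed.

Lemma qdist_lip x x' : `|qdist x - qdist x'| <= C * `|x - x'|.
Proof.
suff h a b : qdist a <= qdist b + C * `|a - b|.
  by rewrite ler_norml; have := h x x'; have := h x' x; rewrite (distrC x'); lra.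
have [y Zy ->] := qdist_attained b.
have := q_lip (a - y) (b - y); rewrite opprB addrA subrK => h.
exact: le_trans (qdist_le _ Zy) h.
Qed.

(** Away from [y0] the minimum over the compact set [Z] exceeds the distance by some
    [e > 0], a gap that survives displacements of [x0] small compared with [e / C]. *)
Lemma qdist_closest_near x0 y0 (V : set 'rV[R]_n) :
  (forall y, Z y -> qdist x0 = q (x0 - y) -> y = y0) -> nbhs y0 V ->
  \forall x \near x0, forall y, Z y -> qdist x = q (x - y) -> V y.
Proof.
move=> uniq /nbhs_interior Vy0.
(* The gap; it is arbitrary when [Z] lies in the interior of [V]. *)
have [e e0 he] : exists2 e : R, 0 < e &
    forall y, Z y -> ~ V° y -> qdist x0 + e <= q (x0 - y).
  pose Z' := Z `&` ~` V°.
  have [Z'0|nZ'] := pselect (Z' !=set0); last first.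
    by exists 1 => // y Zy Vy; case: nZ'; exists y.
  have Z'c : compact Z'.
    apply: compact_closedI => //; apply: open_closedC; exact: open_interior.
  have [|y + hy] := EVT_min_rV Z'0 Z'c (f := fun y => q (x0 - y)).
    by apply: continuous_subspaceT; exact: q_sub_continuous.
  rewrite inE => -[Zy Vy]; exists (q (x0 - y) - qdist x0).
    rewrite subr_gt0 lt_neqAle qdist_le // andbT; apply/eqP => /uniq E.
    by apply: Vy; rewrite E //; exact: nbhs_singleton Vy0.
  by move=> z Zz Vz; rewrite addrC subrK; apply: hy; rewrite inE.
have C1 : 0 < C + 1 by rewrite ltr_wpDl.
apply/near_rowP; exists (e / (4 * (C + 1))); first by rewrite divr_gt0 // mulr_gt0.
move=> x xd y Zy xy; apply: contrapT => nVy.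
have := he y Zy (fun h => nVy (interior_subset h)).
have := q_lip (x0 - y) (x - y); rewrite opprB addrA subrK -xy.
have := qdist_lip x x0; rewrite ler_norml (distrC x0) => /andP[_].
have : C * `|x - x0| <= e / 4.
  have -> : e / 4 = (C + 1) * (e / (4 * (C + 1))) by field; rewrite gt_eqF.
  by rewrite ler_pM // ?lerDl // ltW.
by move: e0; lra.
Qed.

End Distance.

(** * The gauge of a convex body, its polar and its normal cones *)

Section Gauge.
Context {R : realType} {n : nat}.
Variable K : set 'rV[R]_n.
Hypotheses (K_compact : compact K) (K_convex : convex_set K) (K_int0 : K° 0).
Implicit Types (x y w v z : 'rV[R]_n).

Lemma gauge_ge0 (A : set 'rV[R]_n) x : 0 <= gauge A x.
Proof.
have [ne|e] := pselect ([set l : R | 0 < l /\ A (l^-1 *: x)] !=set0).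
  by apply: lb_le_inf => // l [/ltW].
by rewrite /gauge inf_out // => -[].
Qed.

Lemma gauge_le (A : set 'rV[R]_n) x (l : R) : 0 < l -> A (l^-1 *: x) -> gauge A x <= l.
Proof. by move=> l0 Al; apply: ge_inf => //; exists 0 => m [/ltW]. Qed.

Lemma ball_in_K : exists2 r : R, 0 < r & forall x, `|x| < r -> K x.
Proof.
by move: K_int0 => /near_rowP[r r0 rP]; exists r => // x; have := rP x; rewrite subr0.
Qed.

Lemma gauge_bound : exists2 C : R, 0 <= C & forall x, gauge K x <= C * `|x|.
Proof.
have [r r0 rK] := ball_in_K; exists (2 / r); first by rewrite divr_ge0 // ltW.
move=> x; have [->|x0] := eqVneq x 0.
  rewrite normr0 mulr0; apply/ler_addgt0Pl => e e0; rewrite addr0.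
  by apply: gauge_le => //; rewrite scaler0; apply: rK; rewrite normr0.
have xp : 0 < `|x| by rewrite normr_gt0.
have l0 : 0 < 2 / r * `|x| by rewrite mulr_gt0 // divr_gt0.
apply: gauge_le => //; apply: rK; rewrite normrZ gtr0_norm ?invr_gt0 //.
by rewrite invfM mulfVK ?gt_eqF // invf_div ltr_pdivrMr // ltr_pMr // ltr1n.
Qed.

Lemma gauge_set_nonempty x : [set l : R | 0 < l /\ K (l^-1 *: x)] !=set0.
Proof.
have [r r0 rK] := ball_in_K; exists ((`|x| + 1) / r).
have l0 : 0 < (`|x| + 1) / r by rewrite divr_gt0 // ltr_wpDl.
split=> //; apply: rK; rewrite normrZ gtr0_norm ?invr_gt0 // invf_div.
rewrite mulrAC ltr_pdivrMr ?ltr_wpDl // ltr_pM2l //; exact: ltr_pwDr.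
Qed.

Lemma gauge_witness x (m : R) : gauge K x < m ->
  exists l : R, [/\ 0 < l, l < m & K (l^-1 *: x)].
Proof. by move=> /(inf_lt (gauge_set_nonempty x))[l [l0 Kl] lm]; exists l. Qed.

Lemma convex_comb x y (s t : R) : K x -> K y -> 0 <= s -> 0 <= t -> s + t = 1 ->
  K (s *: x + t *: y).
Proof.
move=> Kx Ky s0 t0 st.
have s1 : s <= 1 by rewrite -st lerDl.
have := K_convex (Itv01 s0 s1) (mem_set Kx) (mem_set Ky); rewrite inE.
have t1 : 1 - s = t by rewrite -st addrAC subrr add0r.
by rewrite /conv /= /unstable.onem t1.
Qed.

(** If x / l and y / m lie in [K] then so does (x + y) / (l + m), which is a convex
    combination of them. *)
Lemma gaugeD x y : gauge K (x + y) <= gauge K x + gauge K y.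
Proof.
apply/ler_addgt0Pr => e e0; have e2 : 0 < e / 2 by rewrite divr_gt0.
have [|l [l0 lx Kx]] := @gauge_witness x (gauge K x + e / 2); first by rewrite ltrDl.
have [|m [m0 my Ky]] := @gauge_witness y (gauge K y + e / 2); first by rewrite ltrDl.
have lm0 : 0 < l + m by rewrite addr_gt0.
have : gauge K (x + y) <= l + m.
  apply: gauge_le => //.
  have -> : (l + m)^-1 *: (x + y) =
      (l / (l + m)) *: (l^-1 *: x) + (m / (l + m)) *: (m^-1 *: y).
    rewrite !scalerA scalerDr; congr (_ *: _ + _ *: _); field.
      by rewrite !gt_eqF.
    by rewrite !gt_eqF.
  apply: convex_comb => //; rewrite ?divr_ge0 ?(ltW l0) ?(ltW m0) ?(ltW lm0) //.
  by rewrite -mulrDl divff // gt_eqF.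
by move: lx my; lra.
Qed.

Lemma gauge_lip : exists2 C : R, 0 <= C &
  forall x y, gauge K x <= gauge K y + C * `|x - y|.
Proof.
have [C C0 hC] := gauge_bound; exists C => // x y.
have := gaugeD y (x - y); rewrite addrC subrK => /le_trans; apply.
by rewrite lerD2l hC.
Qed.

Lemma gauge_gt0 x : x != 0 -> 0 < gauge K x.
Proof.
move=> x0; have xp : 0 < `|x| by rewrite normr_gt0.
have [M [Mreal hM]] := compact_bounded K_compact.
(* The bound M of [bounded_set] need not be positive. *)
pose N := Num.max M 0 + 1.
have N0 : 0 < N by rewrite ltr_wpDl // le_max lexx orbT.
have MN : M < N by rewrite ltr_pwDr // le_max lexx.
apply: (@lt_le_trans _ _ (`|x| / N)); first exact: divr_gt0.
apply: lb_le_inf; first exact: gauge_set_nonempty.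
move=> l [l0 /(hM _ MN) /=]; rewrite normrZ gtr0_norm ?invr_gt0 // mulrC.
by rewrite ler_pdivrMr // mulrC -ler_pdivrMr // mulrC.
Qed.

(** The infimum is a limit of admissible scalars, and [K] is closed. *)
Lemma gauge_normalize x : 0 < gauge K x -> K ((gauge K x)^-1 *: x).
Proof.
set l := gauge K x => l0.
have cK : closed K by apply: compact_closed => //; exact: norm_hausdorff.
apply: cK => B /near_rowP[d d0 dP].
have n0 : 0 < `|x| + 1 by rewrite ltr_wpDl.
have m0 : 0 < d * (l * l) / (`|x| + 1) by rewrite divr_gt0 // !mulr_gt0.
have [|l' [l'0 l'm Kl']] := @gauge_witness x (l + d * (l * l) / (`|x| + 1)).
  by rewrite ltrDl.
exists (l'^-1 *: x); split=> //; apply: dP.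
have ll' : l <= l' by exact: gauge_le.
rewrite -scalerBl normrZ.
have -> : l'^-1 - l^-1 = - ((l' - l) / (l * l')) by field; rewrite !gt_eqF.
rewrite normrN ger0_norm; last first.
  by rewrite divr_ge0 ?subr_ge0 // mulr_ge0 // ltW.
rewrite mulrAC ltr_pdivrMr ?mulr_gt0 //.
have h1 : (l' - l) * (`|x| + 1) < d * (l * l).
  by rewrite -ltr_pdivlMr // ltrBlDl.
have h2 : (l' - l) * `|x| <= (l' - l) * (`|x| + 1).
  by rewrite ler_wpM2l ?subr_ge0 // lerDl.
have h3 : d * (l * l) <= d * (l * l') by rewrite !ler_pM2l.
by move: h1 h2 h3; lra.
Qed.

End Gauge.

Section NormalCone.
Context {R : realType} {n : nat}.
Variable K : set 'rV[R]_n.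
Implicit Types (x y w v z : 'rV[R]_n).

(** The gauge of the polar is the support function of [K], and a vector normal to [K]
    at [z] attains its maximum over [K] at [z]. So on the normal cone at [z] the polar
    gauge is linear. *)
Lemma gauge_polar_normal_cone z v :
  K z -> normal_cone K z v -> 0 < dot z v -> gauge (polar K) v = dot z v.
Proof.
move=> Kz Nv zv; apply/eqP; rewrite eq_le; apply/andP; split.
  apply: gauge_le => // y Ky; rewrite dotZl mulrC ler_pdivrMr // mul1r.
  by have := Nv y Ky; rewrite dotBl subr_le0 dotC.
apply: lb_le_inf => [|l [l0 /(_ z Kz)]]; last first.
  by rewrite dotZl mulrC ler_pdivrMr // mul1r dotC.
exists (dot z v); split=> // y Ky; rewrite dotZl mulrC ler_pdivrMr // mul1r.
by have := Nv y Ky; rewrite dotBl subr_le0 dotC.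
Qed.

(** As 0 is interior, [K] contains a small positive multiple of [v]. *)
Lemma dot_normal_cone_gt0 z v :
  K° 0 -> normal_cone K z v -> v != 0 -> 0 < dot z v.
Proof.
move=> /ball_in_K[r r0 rK] Nv v0; have vp : 0 < `|v| + 1 by rewrite ltr_wpDl.
have /Nv : K (r / (`|v| + 1) *: v).
  apply: rK; rewrite normrZ gtr0_norm ?divr_gt0 // mulrAC ltr_pdivrMr //.
  by rewrite ltr_pM2l // ltrDl.
rewrite dotBl dotZl subr_le0; apply: lt_le_trans.
by rewrite mulr_gt0 ?divr_gt0 ?dot_gt0.
Qed.

Hypothesis (K_int0 : K° 0).

(** If w / l lies in [K] then <w, v> <= l <z, v>. *)
Lemma gauge_ge_dot z v w :
  normal_cone K z v -> 0 < dot z v -> dot w v / dot z v <= gauge K w.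
Proof.
move=> Nv zv; apply: lb_le_inf; first exact: gauge_set_nonempty.
move=> l [l0 /Nv]; rewrite dotBl dotZl subr_le0 => h.
by rewrite ler_pdivrMr // mulrC -ler_pdivrMr // mulrC.
Qed.

End NormalCone.

(** * Local defining functions of the domain *)

Section DefiningFunction.
Context {R : realType} {n : nat}.
Implicit Types (U V : set 'rV[R]_n) (x y w v e : 'rV[R]_n).

(** [ld_curve] says that the tangent space of the boundary is the orthogonal of the
    gradient, with tangent vectors understood as velocities of curves. The inward
    normal is defined through such curves, and the first order condition at a closest
    point is derived along them. *)
Record local_defining (k : nat) (alpha : R) U V (Phi : 'rV[R]_n -> R) : Prop := {
  ld_open : open V;
  ld_reg : Ckalpha k alpha Phi V;
  ld_in : forall x, V x -> (U x <-> 0 < Phi x);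
  ld_boundary : forall x, V x -> (boundary U x <-> Phi x = 0);
  ld_grad : forall x, V x -> grad Phi x != 0;
  ld_curve : forall x w, V x -> boundary U x -> dot w (grad Phi x) = 0 ->
    exists2 c : R -> 'rV[R]_n, c 0 = x /\ (\forall t \near (0 : R), boundary U (c t)) &
      is_derive (0 : R) 1 c w }.

Lemma is_derive_dot e x v : is_derive x v (fun x => dot x e) (dot v e).
Proof.
have [d dE] := is_diff_dot e x.
by split; [exact: diff_derivable|rewrite deriveE // dE].
Qed.

Lemma Ckalpha_dot k alpha e (A : set 'rV[R]_n) : open A -> alpha <= 1 ->
  Ckalpha k alpha (fun x => dot x e) A.
Proof.
move=> oA a1.
have c x : {for x, continuous (fun x => dot x e)}.
  by apply: differentiable_continuous; have [] := is_diff_dot e x.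
case: k => [|k]; split => //.
  apply: lipschitz_holder => // x _; exists (n%:R * `|e|); first exact: mulr_ge0.
  exists 1 => // u v _ _; rewrite -dotBl (le_trans (norm_dot_le _ _)) //.
  by rewrite mulrAC.
move=> i; split=> [x _|]; first by have [] := is_derive_dot e x (delta_mx 0 i).
apply: Ckalpha_eq (Ckalpha_cst k alpha (dot (delta_mx 0 i) e) oA) => // x _.
by have [_ ->] := is_derive_dot e x (delta_mx 0 i).
Qed.

(** The height above the graph: its derivative along [e] is 1, so its gradient does
    not vanish, and curves in the boundary are obtained by lifting straight lines. *)
Lemma local_defining_function k alpha U y : open U -> alpha <= 1 ->
  Ckalpha_boundary k.+1 alpha U -> boundary U y ->
  exists V Phi, V y /\ local_defining k.+1 alpha U V Phi.
Proof.
move=> oU a1 Ureg /Ureg[e [phi [V [e1 phi_e [oV Vy] phiC Uphi]]]].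
have ee : dot e e = 1 by rewrite -sqr_enorm e1 expr1n.
pose Phi x := dot x e - phi x.
have PhiC : Ckalpha k.+1 alpha Phi V.
  by apply: CkalphaD => //; [exact: Ckalpha_dot|exact: CkalphaN].
have PhiE x (t : R) : Phi (x + t *: e) = Phi x + t.
  by rewrite /Phi phi_e dotDl dotZl ee mulr1 addrAC.
have dPhi x : V x -> differentiable Phi x.
  by move=> Vx; exact: Ckalpha_differentiable PhiC Vx.
have dphi x : V x -> differentiable phi x.
  by move=> Vx; exact: Ckalpha_differentiable phiC Vx.
have eg x : V x -> dot e (grad Phi x) = 1.
  move=> Vx; rewrite -derive_grad; last exact: dPhi.
  have := @is_derive_from_line _ _ Phi x e 1; case=> //.
  have -> : (fun s : R => Phi (x + s *: e)) = cst (Phi x) + id.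
    by apply/funext => s; rewrite PhiE.
  by rewrite -[X in is_derive _ _ _ X]add0r; apply: is_deriveD.
have inU x : V x -> (U x <-> 0 < Phi x) by move=> /Uphi; rewrite subr_gt0.
have e0 : e != 0 by apply: contra_eq_neq ee => ->; rewrite dot0l eq_sym oner_eq0.
have ep : 0 < `|e| by rewrite normr_gt0.
have bdP x : V x -> Phi x = 0 -> boundary U x.
  move=> Vx Px; apply/boundaryP => //; split; first by rewrite inU // Px ltxx.
  move=> d d0; have /near_rowP[d' d'0 dV] : nbhs x V by exact: open_nbhs_nbhs.
  (* A point just above [x], close enough to stay in [V]. *)
  pose s := Num.min d d' / (2 * `|e|).
  have m0 : 0 < Num.min d d' by rewrite lt_min d0.
  have s0 : 0 < s by rewrite divr_gt0 // mulr_gt0.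
  have se : `|s *: e| < Num.min d d'.
    rewrite normrZ gtr0_norm // /s invfM mulrA mulfVK ?gt_eqF //.
    by rewrite ltr_pdivrMr // ltr_pMr // ltr1n.
  have [sd sd'] := andP (etrans (esym (lt_min _ _ _)) se).
  exists (x + s *: e); last by rewrite addrAC subrr add0r.
  rewrite inU ?PhiE ?Px ?add0r //; apply: dV.
  by rewrite addrAC subrr add0r.
have bd x : V x -> (boundary U x <-> Phi x = 0).
  move=> Vx; split; last exact: bdP.
  move=> /(boundaryP _ oU)[nUx h]; apply/eqP; rewrite eq_le leNgt.
  apply/andP; split; first by apply/negP => /(inU _ Vx).
  rewrite leNgt; apply/negP => Px.
  have e2 : 0 < - Phi x / 2 by rewrite divr_gt0 // oppr_gt0.
  have /continuous_rowP/(_ _ e2)[d d0 dP] := Ckalpha_continuous PhiC Vx.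
  have /near_rowP[d' d'0 dV] : nbhs x V by exact: open_nbhs_nbhs.
  have [|u Uu] := h (Num.min d d'); first by rewrite lt_min d0.
  rewrite lt_min => /andP[/dP + /dV Vu]; rewrite ler_norml => /andP[_].
  by move/(inU _ Vu): Uu; lra.
exists V, Phi; split => //; split => //.
  move=> x Vx; apply: contra_eq_neq (eg x Vx) => ->.
  by rewrite dot0r eq_sym oner_eq0.
move=> x w Vx bx wg.
(* The tangent direction w is split into its part w' in the hyperplane of the
   graph and its vertical part. *)
pose w' := w - dot w e *: e.
have we' : dot w' e = 0 by rewrite dotBl dotZl ee mulr1 subrr.
have gphi : 'D_w' phi x = dot w e.
  have -> : phi = (fun z => dot z e) - Phi.
    by apply/funext => z; rewrite /Phi /GRing.add /= /GRing.opp /= opprB addrCA subrr addr0.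
  have [d1 d1E] := is_derive_dot e x w'.
  rewrite deriveB //; last by apply: diff_derivable; exact: dPhi.
  rewrite d1E we' sub0r derive_grad; last exact: dPhi.
  by rewrite dotBl dotZl eg // wg mulr1 sub0r opprK.
pose c (t : R) := x + t *: w' + (phi (x + t *: w') - phi x) *: e.
have c0 : c 0 = x by rewrite /c scale0r addr0 subrr scale0r addr0.
have dc : is_derive (0 : R) 1 c w.
  have -> : w = 0 + (1 : R) *: w' + (dot w e - 0) *: e.
    by rewrite add0r scale1r subr0 subrK.
  have d3 : is_derive (0 : R) 1 (fun t : R => phi (x + t *: w')) (dot w e).
    rewrite -gphi; have := @is_derive_line _ _ phi x w' 0.
    by rewrite scale0r addr0; apply; apply: diff_derivable; exact: dphi.
  have d2 := is_deriveZl w' (is_derive_id (0 : R) (1 : R)).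
  have d4 := is_deriveZl e (is_deriveB d3 (is_derive_cst (phi x) (0 : R) (1 : R))).
  exact: is_deriveD (is_deriveD (is_derive_cst x (0 : R) (1 : R)) d2) d4.
exists c => //; split => //.
have cc : {for (0 : R), continuous c}.
  by apply: differentiable_continuous; apply/derivable1_diffP; case: dc.
have Vc : \forall t \near (0 : R), V (c t).
  by apply: cc; rewrite c0; exact: open_nbhs_nbhs.
apply: filterS Vc => t Vct; apply: bdP => //.
rewrite [LHS](PhiE (x + t *: w')) /Phi dotDl dotZl we' mulr0 addr0.
move: ((bd x Vx).1 bx); rewrite /Phi; lra.
Qed.

Lemma ld_strict_grad k alpha U V Phi x : local_defining k.+1 alpha U V Phi -> V x ->
  strict_grad Phi x (grad Phi x).
Proof. by move=> h Vx; exact: Ckalpha_strict_grad (ld_open h) (ld_reg h) Vx. Qed.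

(** Both [v] and the gradient are orthogonal to the tangent vectors of [ld_curve],
    hence proportional; that [v] points into [U] decides the sign. *)
Lemma ld_normal k alpha U V Phi x v : local_defining k.+1 alpha U V Phi ->
  V x -> boundary U x -> inward_unit_normal U x v ->
  v = (enorm (grad Phi x))^-1 *: grad Phi x.
Proof.
move=> h Vx bx [v1 v_orth v_in]; set N := grad Phi x.
have N0 : N != 0 := ld_grad h Vx.
have NN := dot_gt0 N0; have Np := enorm_gt0 N0.
pose a := dot v N / dot N N; pose w := v - a *: N.
have wN : dot w N = 0 by rewrite dotBl dotZl divfK ?gt_eqF // subrr.
have wv : dot w v = 0.
  have [c [c0 cb] [cd cE]] := ld_curve h Vx bx wN.
  by rewrite -cE; exact: v_orth.
have vE : v = a *: N.
  apply/eqP; rewrite -subr_eq0; apply/eqP/dot_eq0; rewrite -/w.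
  by rewrite {2}/w dotBr dotZr wN mulr0 subr0.
have a0 : 0 <= a.
  rewrite leNgt; apply/negP => a_lt0.
  have vN : dot v N < 0 by rewrite vE dotZl nmulr_rlt0.
  have v0 : v != 0 by apply: contra_eq_neq v1 => ->; rewrite enorm0 eq_sym oner_eq0.
  have vp : 0 < `|v| by rewrite normr_gt0.
  have e0 : 0 < - dot v N / (2 * `|v|) by rewrite divr_gt0 ?oppr_gt0 ?mulr_gt0.
  have [d d0 dP] := ld_strict_grad h Vx e0.
  have /near_rowP[d' d'0 dV] : nbhs x V by exact: open_nbhs_nbhs (conj (ld_open h) Vx).
  have /nbhs_ballP[b b0 bP] := v_in.
  pose t := Num.min b (Num.min d d' / `|v|) / 2.
  have m0 : 0 < Num.min d d' by rewrite lt_min d0.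
  have m'0 : 0 < Num.min b (Num.min d d' / `|v|) by rewrite lt_min b0 divr_gt0.
  have t0 : 0 < t by rewrite divr_gt0.
  have tm : t < Num.min b (Num.min d d' / `|v|).
    by rewrite ltr_pdivrMr // ltr_pMr // ltr1n.
  move: tm; rewrite lt_min => /andP[tb]; rewrite ltr_pdivlMr // lt_min => /andP[td td'].
  have tv : x + t *: v - x = t *: v by rewrite addrAC subrr add0r.
  have Vt : V (x + t *: v) by apply: dV; rewrite tv normrZ gtr0_norm.
  have Ut : U (x + t *: v).
    by apply: bP => //; rewrite /ball /= sub0r normrN gtr0_norm.
  have := dP (x + t *: v) x; rewrite tv subrr normr0 normrZ gtr0_norm // => /(_ td d0).
  move: Ut; rewrite (ld_in h Vt) => Pt.
  rewrite ((ld_boundary h Vx).1 bx) subr0 dotZl ler_norml => /andP[_].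
  have -> : - dot v N / (2 * `|v|) * (t * `|v|) = - (t * dot v N) / 2.
    by field; rewrite gt_eqF.
  have tvN : t * dot v N < 0 by rewrite pmulr_rlt0.
  rewrite -/N; move: Pt tvN; set p := Phi _; set q := t * _.
  lra.
rewrite {1}vE; congr (_ *: _).
by rewrite -[LHS](mulfK (lt0r_neq0 Np)) -(ger0_norm a0) -enormZ -vE v1 mul1r.
Qed.

Lemma local_defining_subset k alpha U V V' Phi : open V' -> V' `<=` V ->
  local_defining k alpha U V Phi -> local_defining k alpha U V' Phi.
Proof.
move=> oV' V'V [oV C inU bd g c]; split=> //.
- exact: Ckalpha_subset V'V C.
- by move=> x /V'V; exact: inU.
- by move=> x /V'V; exact: bd.
- by move=> x /V'V; exact: g.
- by move=> x w /V'V; exact: c.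
Qed.

End DefiningFunction.

Section UnitNormal.
Context {R : realType} {n : nat}.
Implicit Types (U V A : set 'rV[R]_n) (x y z u v w : 'rV[R]_n).

(** An extension of the inward unit normal off the boundary, so that it can be
    differentiated in all directions. *)
Definition unormal (Phi : 'rV[R]_n -> R) x : 'rV[R]_n :=
  (enorm (grad Phi x))^-1 *: grad Phi x.

Lemma unormal_regular k alpha U V Phi : alpha <= 1 ->
  local_defining k.+1 alpha U V Phi ->
  forall i, Ckalpha k alpha (fun x => unormal Phi x 0 i) V.
Proof.
move=> a1 h; have oV := ld_open h.
have gC i : Ckalpha k alpha (fun x => grad Phi x 0 i) V.
  by apply: Ckalpha_eq (((ld_reg h).2 i).2) => // x _; rewrite mxE.
have NC : Ckalpha k alpha (fun x => dot (grad Phi x) (grad Phi x)) V.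
  pose s i x := grad Phi x 0 i * grad Phi x 0 i.
  apply: Ckalpha_eq (@Ckalpha_sum _ _ k alpha _ (index_enum 'I_n) s V oV _) => //.
    by move=> x _; rewrite dotE.
  by move=> i; exact: CkalphaM.
have N0 x : V x -> 0 < dot (grad Phi x) (grad Phi x).
  by move=> Vx; exact: dot_gt0 (ld_grad h Vx).
have EC := Ckalpha_sqrt oV a1 N0 NC.
have E0 x : V x -> Num.sqrt (dot (grad Phi x) (grad Phi x)) != 0.
  by move=> /N0 Nx; rewrite gt_eqF // sqrtr_gt0.
move=> i; apply: Ckalpha_eq (CkalphaM oV a1 (CkalphaV oV a1 E0 EC) (gC i)) => // x _.
by rewrite [RHS]mxE.
Qed.

Lemma enorm_unormal Phi x : grad Phi x != 0 -> enorm (unormal Phi x) = 1.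
Proof.
move=> /enorm_gt0 g0; rewrite /unormal enormZ ger0_norm ?invr_ge0 ?(ltW g0) //.
by rewrite mulVf // gt_eqF.
Qed.

End UnitNormal.

(** * The closest point is reached along a fixed direction *)

Section Crossing.
Context {R : realType} {n : nat}.
Variables (k : nat) (alpha : R) (U V : set 'rV[R]_n) (Phi : 'rV[R]_n -> R).
Hypothesis ld : local_defining k.+1 alpha U V Phi.
Implicit Types (x y z u v w a b : 'rV[R]_n).

Lemma ld_ball y : V y -> exists2 d : R, 0 < d & forall u, `|u - y| < d -> V u.
Proof. by move=> Vy; apply/near_rowP; apply: open_nbhs_nbhs; split => //; exact: ld_open ld. Qed.

(** Chords of the boundary near [y0] are almost orthogonal to the normal, so tilting
    the normal slightly towards a given chord makes the angle acute. *)
Lemma boundary_chord y0 (l : R) (C : set 'rV[R]_n) :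
  V y0 -> nbhs (l *: grad Phi y0) C ->
  exists2 d : R, 0 < d & forall a b, boundary U a -> boundary U b ->
    `|a - y0| < d -> `|b - y0| < d -> a != b ->
    exists2 v, C v & 0 < dot (b - a) v.
Proof.
move=> Vy0 /near_rowP[r r0 rC]; set g := grad Phi y0.
have l1 : 0 < `|l| + 1 by rewrite ltr_wpDl.
have e0 : 0 < r / (4 * (`|l| + 1)) by rewrite divr_gt0 // mulr_gt0.
have [d1 d10 dP] := ld_strict_grad ld Vy0 e0; have [d2 d20 dV] := ld_ball Vy0.
exists (Num.min d1 d2) => [|a b ba bb]; first by rewrite lt_min d10.
rewrite !lt_min => /andP[a1 a2] /andP[b1 b2] ab.
have ab0 : b - a != 0 by rewrite subr_eq0 eq_sym.
have p : 0 < `|b - a| by rewrite normr_gt0.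
(* The normal, tilted by r / 2 towards the chord. *)
exists (l *: g + (r / 2 / `|b - a|) *: (b - a)).
  apply: rC; rewrite addrAC subrr add0r normrZ gtr0_norm ?divr_gt0 //.
  by rewrite divfK ?gt_eqF // ltr_pdivrMr // ltr_pMr // ltr1n.
rewrite dotDr !dotZr.
have := dP b a b1 a1.
rewrite ((ld_boundary ld (dV a a2)).1 ba) ((ld_boundary ld (dV b b2)).1 bb).
rewrite subrr sub0r normrN -/g => h.
have h1 : `|l * dot (b - a) g| <= r / 4 * `|b - a|.
  rewrite normrM (le_trans (ler_wpM2l (normr_ge0 l) h)) // mulrA ler_wpM2r //.
  have -> : r / 4 = (`|l| + 1) * (r / (4 * (`|l| + 1))) by field; rewrite gt_eqF.
  by rewrite ler_wpM2r ?lerDl // ltW.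
have h2 : r / 2 * `|b - a| <= r / 2 / `|b - a| * dot (b - a) (b - a).
  rewrite -[leRHS]mulrA ler_wpM2l ?divr_ge0 ?(ltW r0) //.
  rewrite mulrC ler_pdivlMr // -expr2; exact: sqr_norm_le_dot.
have rp : 0 < r * `|b - a| by rewrite mulr_gt0.
move: h1 h2; rewrite ler_norml => /andP[]; move: rp; lra.
Qed.

(** Along the line through [y0] the defining function changes sign at [y0]. The signs
    at two points on either side survive a small translation of the line. *)
Lemma boundary_crossing y0 z (t0 d : R) :
  V y0 -> boundary U y0 -> 0 < dot z (grad Phi y0) -> 0 < t0 -> 0 < d ->
  exists2 e : R, 0 < e & forall x, `|x - (y0 + t0 *: z)| < e ->
    exists t : R, [/\ 0 < t, `|x - t *: z - y0| < d & boundary U (x - t *: z)].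
Proof.
move=> Vy0 by0; set g := grad Phi y0; set s := dot z g => s0 t00 d0.
have z1 : 0 < `|z| + 1 by rewrite ltr_wpDl.
have ng1 : 0 < n%:R * `|g| + 1 by rewrite ltr_wpDl // mulr_ge0.
have eps0 : 0 < s / (4 * (`|z| + 1)) by rewrite divr_gt0 // mulr_gt0.
have [d1 d10 dP] := ld_strict_grad ld Vy0 eps0; have [d2 d20 dV] := ld_ball Vy0.
pose D := Num.min d (Num.min d1 d2).
have D0 : 0 < D by rewrite !lt_min d0 d10.
(* The two points at parameters [t0 - eta] and [t0 + eta] lie on either side of the
   boundary, at positive parameters and inside the ball where [Phi] is controlled. *)
pose eta := Num.min (t0 / 2) (D / (4 * (`|z| + 1))).
have eta0 : 0 < eta by rewrite lt_min !divr_gt0 // mulr_gt0.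
have etaz : eta * (`|z| + 1) <= D / 4.
  by rewrite -ler_pdivlMr // -mulrA -invfM /eta ge_min lexx orbT.
have eta_z : eta * `|z| + eta <= D / 4 by move: etaz; rewrite mulrDr mulr1.
have ezD : 0 <= eta * `|z| by rewrite mulr_ge0 // ltW.
have etat0 : eta <= t0 / 2 by rewrite /eta ge_min lexx.
pose e := Num.min eta (s * eta / (4 * (n%:R * `|g| + 1))).
have e0 : 0 < e by rewrite lt_min eta0 divr_gt0 // mulr_gt0.
exists e => // x; set h := x - _ => he.
have he1 : `|h| <= eta by rewrite (le_trans (ltW he)) // /e ge_min lexx.
have he2 : n%:R * `|h| * `|g| <= s * eta / 4.
  have : `|h| * (n%:R * `|g| + 1) <= s * eta / 4.
    have -> : s * eta / 4 = s * eta / (4 * (n%:R * `|g| + 1)) * (n%:R * `|g| + 1).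
      by field; rewrite gt_eqF.
    by rewrite ler_wpM2r ?(ltW ng1) // (le_trans (ltW he)) // /e ge_min lexx orbT.
  by rewrite mulrDr mulr1 mulrCA mulrA; have := normr_ge0 h; lra.
have xE t : x - t *: z = y0 + (h + (t0 - t) *: z).
  by rewrite /h scalerBl opprD (addrA x) subrKA addrA [y0 + _]addrC subrK.
have near t : `|t - t0| <= eta -> `|x - t *: z - y0| < D.
  move=> tt; rewrite xE addrAC subrr add0r (le_lt_trans (ler_normD _ _)) //.
  have : `|(t0 - t) *: z| <= eta * `|z| by rewrite normrZ distrC ler_wpM2r.
  by move: he1 eta_z ezD D0; lra.
have val (c : R) : `|c| = eta -> `|Phi (x - (t0 - c) *: z) - c * s| <= s * eta / 2.
  move=> cE; have tt : `|t0 - c - t0| <= eta by rewrite addrAC subrr add0r normrN cE.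
  have /near := tt; rewrite !lt_min => /and3P[_ n1 _].
  have := dP _ y0 n1; rewrite subrr normr0 => /(_ d10).
  rewrite ((ld_boundary ld Vy0).1 by0) subr0 xE.
  have tc : t0 - (t0 - c) = c by rewrite opprB addrC subrK.
  rewrite [y0 + _ - y0]addrAC subrr add0r tc.
  rewrite dotDl dotZl -/g -/s => hh.
  have h1 : `|dot h g| <= s * eta / 4 by exact: le_trans (norm_dot_le _ _) he2.
  have h2 : s / (4 * (`|z| + 1)) * `|h + c *: z| <= s * eta / 4.
    have : `|h + c *: z| <= eta * (`|z| + 1).
      rewrite (le_trans (ler_normD _ _)) // normrZ cE mulrDr mulr1 addrC.
      by rewrite lerD2l.
    move=> /(ler_wpM2l (ltW eps0)) /le_trans; apply.
    have -> : s / (4 * (`|z| + 1)) * (eta * (`|z| + 1)) = s * eta / 4 by field; rewrite gt_eqF.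
    exact: lexx.
  move: hh h1 h2; rewrite !ler_norml; set P := Phi _; set q := dot h g.
  by set r := _ * `|_|; lra.
have dPhi p : V p -> differentiable Phi p.
  by move=> Vp; exact: Ckalpha_differentiable (ld_open ld) (ld_reg ld) Vp.
have cf : {within `[t0 - eta, t0 + eta], continuous (fun t : R => Phi (x + t *: - z))}.
  apply: derivable_within_continuous => t.
  rewrite in_itv /= => tt; have := @is_derive_line _ _ Phi x (- z) t.
  case=> //; apply/diff_derivable/dPhi/dV; rewrite scalerN.
  have : `|t - t0| <= eta by rewrite ler_norml; move: tt; lra.
  by move=> /near; rewrite !lt_min => /and3P[].
have vp := val eta (gtr0_norm eta0).
have vm : `|Phi (x - (t0 + eta) *: z) + eta * s| <= s * eta / 2.
  by have := val (- eta); rewrite normrN gtr0_norm // opprK mulNr opprK; exact.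
have se : 0 < s * eta by rewrite mulr_gt0.
have [| |t] := @IVT _ (fun t : R => Phi (x + t *: - z)) (t0 - eta) (t0 + eta) 0 _ cf.
- by rewrite lerD2l; move: eta0; lra.
- rewrite !scalerN ge_min le_max; apply/andP; split; apply/orP; [right|left].
    by move: vm; rewrite ler_norml; move: se; lra.
  by move: vp; rewrite ler_norml; move: se; lra.
rewrite in_itv /= scalerN => tt Pt; exists t.
have /near : `|t - t0| <= eta by rewrite ler_norml; move: tt; lra.
rewrite !lt_min => /and3P[n0 _ n2].
split => //; first by move: tt etat0 t00; lra.
by apply/(ld_boundary ld) => //; exact: dV.
Qed.

End Crossing.

Section ClosestPoint.
Context {R : realType} {n : nat}.
Variables (K U : set 'rV[R]_n).
Hypotheses (K_compact : compact K) (K_convex : convex_set K) (K_int0 : K° 0).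
Hypotheses (U_open : open U) (U_bounded : bounded_set U).
Implicit Types (x y z u v w a b : 'rV[R]_n).

Variables (x0 y0 v0 : 'rV[R]_n).
Hypothesis x0U : U x0.
Hypothesis y0_closest : closest_point K U x0 y0.
Hypothesis y0_unique : forall y, closest_point K U x0 y -> y = y0.

Let rho := gauge_dist K U.
Definition closest_direction : 'rV[R]_n := (gauge_dist K U x0)^-1 *: (x0 - y0).
Local Notation z0 := closest_direction.

Let by0 : boundary U y0 := y0_closest.1.

Let bd_compact : compact (boundary U) := boundary_compact U_bounded.

Let bd_nonempty : boundary U !=set0.
Proof. by exists y0; exact: by0. Qed.

Lemma rho_gt0 : 0 < rho x0.
Proof.
rewrite /rho y0_closest.2; apply: (gauge_gt0 K_compact K_int0); rewrite subr_eq0; apply/eqP => E.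
by apply: (boundary_not_open U_open by0); rewrite -E.
Qed.

Lemma closest_direction_in : K z0.
Proof.
by rewrite /z0 y0_closest.2; apply: gauge_normalize => //; rewrite -y0_closest.2 rho_gt0.
Qed.

Lemma start_decomposition : x0 = y0 + rho x0 *: z0.
Proof. by rewrite scalerA divff ?gt_eqF ?rho_gt0 // scale1r addrC subrK. Qed.

Lemma rho_lip : exists2 C : R, 0 <= C & forall x u, `|rho x - rho u| <= C * `|x - u|.
Proof.
have [C C0 hC] := gauge_lip K_convex K_int0; exists C => // x u.
exact: (qdist_lip (@gauge_ge0 _ _ K) C0 hC bd_compact bd_nonempty).
Qed.

(** On the ray from [x] in the direction opposite to [closest_direction]; for [x] near
    [x0] it is the closest point. *)
Definition ray_foot x : 'rV[R]_n := x - gauge_dist K U x *: z0.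

Lemma ray_foot_lip :
  exists2 L : R, 0 <= L & forall x u, `|ray_foot x - ray_foot u| <= L * `|x - u|.
Proof.
have [C C0 hC] := rho_lip; exists (1 + C * `|z0|); first by rewrite addr_ge0 // mulr_ge0.
move=> x u.
have -> : ray_foot x - ray_foot u = (x - u) - (rho x - rho u) *: z0.
  by rewrite /ray_foot scalerBl opprB opprB addrACA [RHS]addrACA [- u + _]addrC.
rewrite (le_trans (ler_normB _ _)) // mulrDl mul1r lerD2l normrZ mulrAC.
by rewrite ler_wpM2r.
Qed.

Variables (k : nat) (alpha : R) (V : set 'rV[R]_n) (Phi : 'rV[R]_n -> R).
Hypothesis ld : local_defining k.+1 alpha U V Phi.
Hypothesis Vy0 : V y0.
Hypothesis v0E : v0 = unormal Phi y0.
Hypothesis v0_int : (normal_cone K z0)° v0.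

Lemma dot_cone_gt0 v : normal_cone K z0 v -> enorm v = 1 -> 0 < dot z0 v.
Proof.
move=> Nv v1; apply: (dot_normal_cone_gt0 K_int0 Nv).
by apply: contra_eq_neq v1 => ->; rewrite enorm0 eq_sym oner_eq0.
Qed.

(** Let [x - t z0] be the point where the ray meets the boundary. For another boundary
    point [p], [boundary_chord] provides a normal vector [v] at [z0] that makes an acute
    angle with the chord from [p] to [x - t z0], and [gauge_ge_dot] for this [v] shows
    that the gauge of x - p exceeds t. *)
Lemma closest_point_near (d : R) : 0 < d -> \forall x \near x0,
  [/\ boundary U (ray_foot x), `|ray_foot x - y0| < d,
      closest_point K U x (ray_foot x) &
      forall p, closest_point K U x p -> p = ray_foot x].
Proof.
move=> d0.
have Nv0 : normal_cone K z0 v0 := interior_subset v0_int.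
have v01 : enorm v0 = 1 by rewrite v0E enorm_unormal //; exact: ld_grad ld _ Vy0.
have zv0 := dot_cone_gt0 Nv0 v01.
have cone_nbhs : nbhs ((enorm (grad Phi y0))^-1 *: grad Phi y0) (normal_cone K z0).
  by rewrite -/(unormal Phi y0) -v0E.
have [d1 d10 chord] := boundary_chord ld Vy0 cone_nbhs.
have zg : 0 < dot z0 (grad Phi y0).
  move: zv0; rewrite v0E /unormal dotZr pmulr_rgt0 // invr_gt0.
  by apply: enorm_gt0; exact: ld_grad ld _ Vy0.
have D0 : 0 < Num.min d d1 by rewrite lt_min d0.
have [e e0 crossing] := boundary_crossing ld Vy0 by0 zg rho_gt0 D0.
have [C C0 hC] := gauge_lip K_convex K_int0.
have near_y0 : nbhs y0 [set p | `|p - y0| < d1] by apply/near_rowP; exists d1.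
have unique_y0 y : boundary U y ->
    qdist (gauge K) (boundary U) x0 = gauge K (x0 - y) -> y = y0.
  by move=> yb yE; apply: y0_unique.
have := qdist_closest_near (@gauge_ge0 _ _ K) C0 hC bd_compact bd_nonempty unique_y0 near_y0.
move=> /near_rowP[e' e'0 close].
apply/near_rowP; exists (Num.min e e'); first by rewrite lt_min e0.
move=> x; rewrite lt_min {1}start_decomposition => /andP[xe xe'].
have [t [t0 ty tb]] := crossing x xe; move: ty; rewrite lt_min => /andP[tyd tyd1].
have gt : gauge K (x - (x - t *: z0)) <= t.
  rewrite opprB addrC subrK; apply: gauge_le => //.
  by rewrite scalerA mulVf ?gt_eqF // scale1r; exact: closest_direction_in.
have uniq p : closest_point K U x p -> p = x - t *: z0.
  move=> [pb pE]; apply/eqP/negPn/negP => pn.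
  have [v Nv pv] := chord p (x - t *: z0) pb tb (close x xe' p pb pE) tyd1 pn.
  have v_neq0 : v != 0 by apply: contraTneq pv => ->; rewrite dot0r ltxx.
  have zv := dot_normal_cone_gt0 K_int0 Nv v_neq0.
  have := gauge_ge_dot K_int0 (x - p) Nv zv.
  have -> : x - p = t *: z0 + (x - t *: z0 - p) by rewrite addrA addrCA subrr addr0.
  rewrite dotDl dotZl mulrDl mulfK ?gt_eqF //.
  have : 0 < dot (x - t *: z0 - p) v / dot z0 v by rewrite divr_gt0.
  have := qdist_le (@gauge_ge0 _ _ K) x tb.
  have -> : t *: z0 + (x - t *: z0 - p) = x - p by rewrite addrA addrCA subrr addr0.
  rewrite -pE /gauge_dist -/(qdist (gauge K) (boundary U) x); move: gt; lra.
have [p pb pE] := qdist_attained (@gauge_ge0 _ _ K) C0 hC bd_compact bd_nonempty x.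
have pt : p = x - t *: z0 by exact: uniq.
have rhot : gauge_dist K U x = t.
  apply/eqP; rewrite eq_le; apply/andP; split.
    by apply: le_trans gt; exact: (qdist_le (@gauge_ge0 _ _ K) x tb).
  rewrite /gauge_dist -/(qdist (gauge K) (boundary U) x) pE pt opprB addrC subrK.
  have := gauge_ge_dot K_int0 (t *: z0) Nv0 zv0.
  by rewrite dotZl mulfK // gt_eqF.
have hE : ray_foot x = x - t *: z0 by rewrite /ray_foot rhot.
by rewrite hE; split => //; rewrite -pt.
Qed.

End ClosestPoint.

(** * Regularity of the distance and of the closest point *)

Section RayRegularity.
Context {R : realType} {n : nat}.
Variables (k : nat) (alpha : R) (U V A : set 'rV[R]_n) (Phi rho : 'rV[R]_n -> R).
Variables (z : 'rV[R]_n) (L : R).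
Hypothesis ld : local_defining k.+1 alpha U V Phi.
Hypotheses (alpha_ge0 : 0 <= alpha) (alpha_le1 : alpha <= 1).
Hypothesis transversal : forall p, V p -> 0 < dot z (unormal Phi p).
Let y x := x - rho x *: z.
Hypothesis A_open : open A.
Hypothesis L_ge0 : 0 <= L.
Hypothesis y_lip : forall x u, `|y x - y u| <= L * `|x - u|.
Hypothesis yV : forall x, A x -> V (y x).
Hypothesis y_boundary : forall x, A x -> boundary U (y x).
Implicit Types (x u v w p : 'rV[R]_n).

(** nu / <z, nu> at the foot [p], with nu extended off the boundary: the gradient of the
    distance measured along z. *)
Definition ray_grad Phi (z p : 'rV[R]_n) : 'rV[R]_n :=
  (dot z (unormal Phi p))^-1 *: unormal Phi p.
Local Notation G := (ray_grad Phi z).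

Let V_open : open V := ld_open ld.

Lemma ray_gradE p : V p -> G p = (dot z (grad Phi p))^-1 *: grad Phi p.
Proof.
move=> Vp; have N0 := enorm_gt0 (ld_grad ld Vp).
rewrite /ray_grad /unormal dotZr scalerA invfM invrK mulrAC mulfV ?gt_eqF //.
by rewrite mul1r.
Qed.

Lemma grad_transversal p : V p -> 0 < dot z (grad Phi p).
Proof.
move=> Vp; have N0 := enorm_gt0 (ld_grad ld Vp).
by have := transversal Vp; rewrite /unormal dotZr pmulr_rgt0 // invr_gt0.
Qed.

(** Both [y u] and [y x] are zeros of [Phi], and y u - y x = (u - x) - (rho u - rho x) z.
    Expanding [Phi] at [y x] gives a linear equation for rho u - rho x, which
    transversality solves. *)
Lemma ray_frechet x : A x -> frechet rho x (dot^~ (G (y x))).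
Proof.
move=> Ax e e0; set g := grad Phi (y x); set s := dot z g.
have s0 : 0 < s by exact: grad_transversal (yV Ax).
have L1 : 0 < L + 1 by rewrite ltr_wpDl.
have e'0 : 0 < e * s / (L + 1) by rewrite divr_gt0 // mulr_gt0.
have [d d0 dP] := ld_strict_grad ld (yV Ax) e'0.
have /near_rowP[d' d'0 dA] : nbhs x A by exact: open_nbhs_nbhs.
apply/near_rowP; exists (Num.min d' (d / (L + 1))).
  by rewrite lt_min d'0 divr_gt0.
move=> u; rewrite lt_min => /andP[/dA Au ud].
have yud : `|y u - y x| < d.
  apply: le_lt_trans (y_lip u x) _; apply: le_lt_trans (_ : (L + 1) * `|u - x| < d).
    by rewrite ler_wpM2r // lerDl.
  by rewrite mulrC -ltr_pdivlMr.
have := dP (y u) (y x) yud; rewrite subrr normr0 => /(_ d0).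
rewrite ((ld_boundary ld (yV Au)).1 (y_boundary Au)).
rewrite ((ld_boundary ld (yV Ax)).1 (y_boundary Ax)) subrr sub0r normrN -/g.
have -> : y u - y x = (u - x) - (rho u - rho x) *: z.
  by rewrite /y scalerBl opprB opprB addrACA [RHS]addrACA [- x + _]addrC.
rewrite (dotBl (u - x)) dotZl -/s => h.
rewrite (ray_gradE (yV Ax)) dotZr -/g -/s.
have -> : rho u - rho x - s^-1 * dot (u - x) g =
    - (dot (u - x) g - (rho u - rho x) * s) / s by field; rewrite gt_eqF.
rewrite normrM normrN normfV (gtr0_norm s0) ler_pdivrMr //.
apply: le_trans h _; have -> : (u - x) - (rho u - rho x) *: z = y u - y x.
  by rewrite /y scalerBl opprB opprB addrACA [RHS]addrACA [- x + _]addrC.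
apply: le_trans (ler_wpM2l (ltW e'0) (y_lip u x)) _.
have -> : e * s / (L + 1) * (L * `|u - x|) = e * `|u - x| * s * (L / (L + 1)).
  by field; rewrite gt_eqF.
rewrite ler_piMr ?mulr_ge0 ?(ltW e0) ?(ltW s0) //.
by rewrite ler_pdivrMr // mul1r lerDl.
Qed.

Lemma ray_is_diff x : A x -> is_diff x y (fun v => v - dot v (G (y x)) *: z).
Proof.
move=> Ax; have [d dE] := frechet_dot_is_diff (ray_frechet Ax).
have h : is_diff x (fun u => rho u *: z) (fun v => dot v (G (y x)) *: z).
  split; first exact: differentiableZl.
  by apply/funext => v; rewrite diffZl // dE.
exact: is_diffB (is_diff_id x) h.
Qed.

Lemma ray_grad_regular i : Ckalpha k alpha (fun p => G p 0 i) V.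
Proof.
have mC := unormal_regular alpha_le1 ld.
have zC : Ckalpha k alpha (fun p => dot z (unormal Phi p)) V.
  pose s i p := z 0 i * unormal Phi p 0 i.
  apply: Ckalpha_eq (@Ckalpha_sum _ _ k alpha _ (index_enum 'I_n) s V V_open _) => //.
    by move=> x _; rewrite dotE.
  move=> j; apply: CkalphaM => //; exact: Ckalpha_cst.
have z_neq0 p : V p -> dot z (unormal Phi p) != 0.
  by move=> Vp; rewrite gt_eqF // transversal.
apply: Ckalpha_eq (CkalphaM V_open alpha_le1 (CkalphaV V_open alpha_le1 z_neq0 zC) (mC i)) => //.
by move=> p _; rewrite [RHS]mxE.
Qed.

(** When x moves by e_i, its foot y moves by e_i - G_i z to first order; so this is the
    derivative of [f \o y] along e_i, read as a function of the foot. *)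
Definition ray_derive i (f : 'rV[R]_n -> R) p : R :=
  'D_(delta_mx 0 i) f p - G p 0 i * \sum_j z 0 j * 'D_(delta_mx 0 j) f p.

Lemma is_derive_ray f x i : differentiable f (y x) -> A x ->
  is_derive x (delta_mx 0 i : 'rV[R]_n) (f \o y) (ray_derive i f (y x)).
Proof.
move=> df Ax; have [dy dyE] := ray_is_diff Ax.
split; first by apply: diff_derivable; exact: differentiable_comp.
rewrite deriveE; last exact: differentiable_comp.
rewrite diff_comp // /= dyE -deriveE // derive_grad // dotBl dotZl !dot_delta.
rewrite /ray_derive mxE; congr (_ - _ * _); rewrite dotE.
by apply: eq_bigr => j _; rewrite mxE.
Qed.

Lemma y_continuous x : {for x, continuous y}.
Proof.
apply/continuous_rowP => e e0; have L1 : 0 < L + 1 by rewrite ltr_wpDl.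
exists (e / (L + 1)) => [|u]; first by rewrite divr_gt0.
rewrite ltr_pdivlMr // => ud; apply: le_trans (y_lip u x) _.
by apply: le_trans (ltW ud); rewrite mulrC ler_wpM2l // lerDl.
Qed.

(** By induction: differentiating [f \o y] amounts to applying [ray_derive], which
    uses up one derivative of [f] and has coefficients of class C^{k,alpha}. *)
Lemma Ckalpha_ray j (f : 'rV[R]_n -> R) : (j <= k.+1)%N -> Ckalpha j alpha f V ->
  Ckalpha j alpha (f \o y) A.
Proof.
elim: j f => [|j ih] f jk fV.
  split=> [x Ax|].
    apply: continuous_comp; first exact: y_continuous.
    exact: Ckalpha_continuous fV (yV Ax).
  apply/holder_onP => x Ax.
  have [C C0 [d d0 dP]] := (holder_onP _ _ _).1 fV.2 _ (yV Ax).
  have L1 : 0 < L + 1 by rewrite ltr_wpDl.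
  exists (C * L `^ alpha); first by rewrite mulr_ge0 // powR_ge0.
  exists (d / (L + 1)); first by rewrite divr_gt0.
  have near u : `|u - x| < d / (L + 1) -> `|y u - y x| < d.
    rewrite ltr_pdivlMr // => ud; apply: le_lt_trans (y_lip u x) _.
    by apply: le_lt_trans ud; rewrite mulrC ler_wpM2l // lerDl.
  move=> u v /near ud /near vd; apply: le_trans (dP _ _ ud vd) _.
  rewrite -mulrA -powRM // ler_wpM2l //.
  by apply: ge0_ler_powR; rewrite ?nnegrE ?mulr_ge0.
split=> [x Ax|i].
  apply: continuous_comp; first exact: y_continuous.
  exact: Ckalpha_continuous fV (yV Ax).
have df x : A x -> differentiable f (y x).
  by move=> Ax; exact: Ckalpha_differentiable V_open fV (yV Ax).
split=> [x Ax|]; first by have [] := is_derive_ray i (df x Ax) Ax.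
have jk' : (j <= k.+1)%N by exact: ltnW.
apply: Ckalpha_eq (ih (ray_derive i f) jk' _) => // [x|].
  by rewrite inE => Ax; have [_ ->] := is_derive_ray i (df x Ax) Ax.
have GC := Ckalpha_geq V_open alpha_le1 (jk : (j <= k)%N) (ray_grad_regular i).
pose s l p := z 0 l * 'D_(delta_mx 0 l) f p.
have sC : Ckalpha j alpha (fun p => \sum_l s l p) V.
  apply: Ckalpha_sum => // l; apply: CkalphaM => //; first exact: Ckalpha_cst.
  exact: (fV.2 l).2.
by apply: CkalphaD => //; [exact: (fV.2 i).2|apply: CkalphaN => //; exact: CkalphaM].
Qed.

Lemma ray_grad_rho x : A x -> differentiable rho x /\ grad rho x = G (y x).
Proof.
move=> Ax; have h := ray_frechet Ax; split; last exact: frechet_grad.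
by have [] := frechet_dot_is_diff h.
Qed.

Lemma ray_rho_regular : Ckalpha k.+1 alpha rho A.
Proof.
split=> [x Ax|i].
  by apply: differentiable_continuous; exact: (ray_grad_rho Ax).1.
split=> [x Ax|]; first by apply: diff_derivable; exact: (ray_grad_rho Ax).1.
apply: Ckalpha_eq (Ckalpha_ray (leqnSn k) (ray_grad_regular i)) => // x.
rewrite inE => Ax; rewrite /= -(ray_grad_rho Ax).2.
by rewrite mxE.
Qed.

Lemma ray_y_regular : Ckalpha k.+1 alpha y A.
Proof.
apply: CkalphaD => //.
  split=> [x _|i]; first by move=> B.
  split=> [x _|]; first exact: derivable_id.
  by apply: Ckalpha_eq (Ckalpha_cst k alpha _ A_open) => // x _; rewrite derive_id.
have := CkalphaZl (- z) A_open ray_rho_regular; apply: Ckalpha_eq => // x _.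
by rewrite scalerN.
Qed.

End RayRegularity.

(** * Vector fields and matrix-valued maps *)

Section MatrixLimits.
Context {R : realType} {T : Type} {F : set_system T} {FF : Filter F}.

Definition entry_cvg {m n} (A : T -> 'M[R]_(m, n)) (L : 'M[R]_(m, n)) : Prop :=
  forall i j, A x i j @[x --> F] --> L i j.

Lemma entry_cvg_cvg {m n} (A : T -> 'M[R]_(m, n)) L : entry_cvg A L -> A x @[x --> F] --> L.
Proof.
move=> AL; apply/cvgrPdist_le => e e0.
have : \forall x \near F, forall ij : 'I_m * 'I_n, `|L ij.1 ij.2 - A x ij.1 ij.2| <= e.
  apply: (@filter_forall _ _ (fun (ij : 'I_m * 'I_n) x => `|L ij.1 ij.2 - A x ij.1 ij.2| <= e) F).
  by move=> [i j] /=; have /cvgrPdist_le/(_ e e0) := AL i j.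
apply: filterS => x xe; rewrite [leLHS]/Num.Def.normr /= mx_normrE.
by apply: bigmax_le => [|ij _]; [exact: ltW|rewrite !mxE; exact: xe].
Qed.

Lemma entry_cvg_cst {m n} (L : 'M[R]_(m, n)) : entry_cvg (fun _ => L) L.
Proof. by move=> i j; exact: cvg_cst. Qed.

Lemma entry_cvgD {m n} (A B : T -> 'M[R]_(m, n)) L M :
  entry_cvg A L -> entry_cvg B M -> entry_cvg (fun x => A x + B x) (L + M).
Proof.
move=> AL BM i j; rewrite mxE.
rewrite (_ : (fun x => _) = (fun x => A x i j + B x i j)); first exact: cvgD.
by apply/funext => x; rewrite mxE.
Qed.

Lemma entry_cvgZ {m n} (f : T -> R) (A : T -> 'M[R]_(m, n)) (l : R) L :
  f x @[x --> F] --> l -> entry_cvg A L -> entry_cvg (fun x => f x *: A x) (l *: L).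
Proof.
move=> fl AL i j; rewrite mxE.
rewrite (_ : (fun x => _) = (fun x => f x * A x i j)); first exact: cvgM.
by apply/funext => x; rewrite mxE.
Qed.

Lemma entry_cvgM {m n p} (A : T -> 'M[R]_(m, n)) (B : T -> 'M[R]_(n, p)) L M :
  entry_cvg A L -> entry_cvg B M -> entry_cvg (fun x => A x *m B x) (L *m M).
Proof.
move=> AL BM i j; rewrite mxE.
rewrite (_ : (fun x => _) = (fun x => \sum_k A x i k * B x k j)); last first.
  by apply/funext => x; rewrite mxE.
apply: (@cvg_big R _ +%R 0 xpredT add_continuous _ F _ _ _ FF) => k _.
exact: cvgM.
Qed.

Lemma entry_cvg_tr {m n} (A : T -> 'M[R]_(m, n)) L : entry_cvg A L -> entry_cvg (fun x => (A x)^T) L^T.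
Proof.
move=> AL i j; rewrite mxE (_ : (fun x => _) = (fun x => A x j i)) //.
by apply/funext => x; rewrite mxE.
Qed.

Lemma entry_cvg_det {n} (A : T -> 'M[R]_n) L : entry_cvg A L ->
  \det (A x) @[x --> F] --> \det L.
Proof.
move=> AL; rewrite /determinant.
apply: (@cvg_big R _ +%R 0 xpredT add_continuous _ F _ _ _ FF) => s _.
apply: cvgM; first exact: cvg_cst.
by apply: (@cvg_big R _ *%R 1 xpredT mul_continuous _ F _ _ _ FF) => i _; exact: AL.
Qed.

(** By Cramer's rule the entries of the inverse are quotients of polynomials in the
    entries. *)
Lemma entry_cvg_inv {n} (A : T -> 'M[R]_n) L : entry_cvg A L -> \det L != 0 ->
  entry_cvg (fun x => invmx (A x)) (invmx L).
Proof.
move=> AL L0 i j; have /cvgr_neq0/(_ L0) A0 := entry_cvg_det AL.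
rewrite /invmx unitmxE unitfE L0 !mxE.
have h : (\det (A x))^-1 * cofactor (A x) j i @[x --> F] --> (\det L)^-1 * cofactor L j i.
  apply: cvgM; first by apply: cvgV => //; exact: entry_cvg_det.
  apply: cvgM; first exact: cvg_cst.
  apply: entry_cvg_det => a b; rewrite !mxE.
  rewrite (_ : (fun x => _) = (fun x => A x (lift j a) (lift i b))) //.
  by apply/funext => x; rewrite !mxE.
apply: cvg_trans h; apply: near_eq_cvg; apply: filterS A0 => x Ax.
by rewrite unitmxE unitfE Ax !mxE.
Qed.

End MatrixLimits.

Section VectorFields.
Context {R : realType} {n : nat}.
Implicit Types (f : 'rV[R]_n -> 'rV[R]_n) (a u v : 'rV[R]_n) (J : 'M[R]_n).

Lemma mulmx_lip J : exists2 c : R, 0 <= c & forall v, `|v *m J| <= c * `|v|.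
Proof.
exists (\sum_i \sum_j `|J i j|); first by do 2!(apply: sumr_ge0 => ? _).
move=> v; apply: norm_le_entries => [|j].
  by rewrite mulr_ge0 //; do 2!(apply: sumr_ge0 => ? _).
rewrite mxE (le_trans (ler_norm_sum _ _ _)) // mulr_suml ler_sum // => i _.
rewrite normrM mulrC ler_pM // ?entry_le_norm // (bigD1 j) //= lerDl.
by apply: sumr_ge0.
Qed.

Lemma common_radius (P : 'I_n -> R -> Prop) :
  (forall i d d', d' <= d -> P i d -> P i d') ->
  (forall i, exists2 d : R, 0 < d & P i d) ->
  exists2 d : R, 0 < d & forall i, P i d.
Proof.
move=> mono ex.
have /choice[D hD] : forall i, exists d : R, 0 < d /\ P i d.
  by move=> i; have [d d0 Pd] := ex i; exists d.
exists (\big[Num.min/1]_i D i).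
  by apply: lt_bigmin => // i _; have [] := hD i.
by move=> i; apply: mono (hD i).2; exact: bigmin_le.
Qed.

Definition strict_jac f a J : Prop :=
  forall e : R, 0 < e -> exists2 d : R, 0 < d &
    forall u v, `|u - a| < d -> `|v - a| < d ->
    `|f u - f v - (u - v) *m J| <= e * `|u - v|.

Definition jac f a : 'M[R]_n :=
  \matrix_(i, j) 'D_(delta_mx 0 i) (fun u => f u 0 j) a.

Lemma mul_jac f a v j : (v *m jac f a) 0 j = dot v (grad (fun u => f u 0 j) a).
Proof. by rewrite mxE dotE; apply: eq_bigr => i _; rewrite !mxE. Qed.

Lemma strict_jac_of_entries f a :
  (forall j, strict_grad (fun u => f u 0 j) a (grad (fun u => f u 0 j) a)) ->
  strict_jac f a (jac f a).
Proof.
move=> fj e e0.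
pose P j (d : R) := forall u v, `|u - a| < d -> `|v - a| < d ->
  `|f u 0 j - f v 0 j - dot (u - v) (grad (fun u => f u 0 j) a)| <= e * `|u - v|.
have [|j|d d0 dP] := @common_radius P.
- by move=> j d d' dd h u v ud vd; apply: h; [apply: lt_le_trans ud _|apply: lt_le_trans vd _].
- by have [d d0 dP] := fj j e e0; exists d.
exists d => // u v ud vd; apply: norm_le_entries => [|j].
  by rewrite mulr_ge0 // ltW.
by have := dP j u v ud vd; rewrite -mul_jac !mxE.
Qed.

Lemma strict_jac_frechet f a J : strict_jac f a J -> frechet f a (mulmxr J).
Proof.
move=> h e e0; have [d d0 dP] := h e e0; apply/near_rowP; exists d => // u ud.
by apply: dP => //; rewrite subrr normr0.
Qed.

Lemma strict_jac_lip f a J : strict_jac f a J ->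
  exists2 L : R, 0 < L & exists2 d : R, 0 < d &
  forall u v, `|u - a| < d -> `|v - a| < d -> `|f u - f v| <= L * `|u - v|.
Proof.
move=> /(_ 1 ltr01)[d d0 dP]; have [c c0 hc] := mulmx_lip J.
exists (1 + c); first by rewrite ltr_pwDl.
exists d => // u v ud vd; rewrite -(subrK ((u - v) *m J) (f u - f v)).
by rewrite (le_trans (ler_normD _ _)) // mulrDl lerD ?dP.
Qed.

Lemma jacobian_eq f a J : is_diff a f (mulmxr J) -> 'J f a = J.
Proof.
move=> [df dE]; rewrite /jacobian dE; apply/row_matrixP => i.
by rewrite rowE mul_rV_lin1 /= -rowE.
Qed.

(** The Jacobian [S] of the gradient carries the second derivatives. The Hoelder
    condition with exponent 0 is local boundedness, a consequence of continuity. *)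
Lemma C2_of_gradient (d : 'rV[R]_n -> R) (g : 'rV[R]_n -> 'rV[R]_n)
    (S : 'rV[R]_n -> 'M[R]_n) (D : set 'rV[R]_n) :
  open D ->
  (forall x, D x -> frechet d x (dot^~ (g x))) ->
  (forall x, D x -> is_diff x g (mulmxr (S x))) ->
  (forall x, D x -> entry_cvg (F := nbhs x) S (S x)) ->
  Ckalpha 2 0 d D /\ forall x, D x -> hessian d x = (S x)^T.
Proof.
move=> oD dg gS cS.
have gradE x : D x -> grad d x = g x by move=> Dx; exact: frechet_grad (dg x Dx).
have dd x : D x -> differentiable d x.
  by move=> Dx; have [] := frechet_dot_is_diff (dg x Dx).
have cg x : D x -> {for x, continuous g}.
  by move=> Dx; apply: differentiable_continuous; have [] := gS x Dx.
have Dg x i j : D x -> derivable (fun u => g u 0 j) x (delta_mx 0 i) /\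
    'D_(delta_mx 0 i) (fun u => g u 0 j) x = S x i j.
  move=> Dx; have [dgx gE] := gS x Dx.
  have dgi : derivable g x (delta_mx 0 i) by exact: diff_derivable.
  split; first exact: (derivable_mxP _ _ _).1 dgi 0 j.
  have := derive_mx dgi; rewrite deriveE // gE /= -rowE => /rowP/(_ j).
  by rewrite !mxE.
split.
  split; first by move=> x Dx; apply: differentiable_continuous; exact: dd.
  move=> i; split; first by move=> x Dx; apply: diff_derivable; exact: dd.
  apply: (@Ckalpha_eq _ _ _ _ _ (fun u => g u 0 i)) => //.
    by move=> x; rewrite inE => Dx; rewrite -gradE // mxE.
  split.
    move=> x Dx; exact: (@continuous_comp _ _ _ g (fun v : 'rV[R]_n => v 0 i) x
      (cg x Dx) (@coord_continuous _ _ _ 0 i (g x))).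
  move=> j; split; first by move=> x Dx; exact: (Dg x j i Dx).1.
  apply: (@Ckalpha_eq _ _ _ _ _ (fun u => S u j i)) => //.
    by move=> x; rewrite inE => Dx; rewrite (Dg x j i Dx).2.
  split; first by move=> x Dx; exact: cS.
  apply/holder_onP => x Dx; exists 2 => //.
  have /continuous_rowP/(_ 1 ltr01)[r r0 rP] : {for x, continuous (fun u => S u j i)}.
    exact: cS.
  exists r => // u v ur vr; rewrite powRr0 mulr1 -(subrK (S x j i) (S u j i)).
  rewrite -addrA (le_trans (ler_normD _ _)) // (distrC (S x j i)).
  by rewrite -[2]/(1 + 1) lerD // rP.
move=> x Dx; rewrite /hessian /Dmx; congr (_^T); apply: jacobian_eq.
apply: frechet_is_diff; have := is_diff_frechet (gS x Dx).
apply: small_at_eq; have : nbhs x D by exact: open_nbhs_nbhs.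
by apply: filterS => u Du; rewrite !gradE.
Qed.

End VectorFields.

(** * The Euclidean distance near the boundary *)

Lemma derive_at_local_min {R : realType} (g : R -> R) (l : R) :
  is_derive (0 : R) 1 g l -> (\forall t \near (0 : R), g 0 <= g t) -> l = 0.
Proof.
move=> [dg gl] /nbhs_ballP[r1 r10 gmin]; apply/eqP/negPn/negP => l0.
have lp : 0 < `|l| by rewrite normr_gt0.
have l2 : 0 < `|l| / 2 by rewrite divr_gt0.
have cg : (fun h : R => h^-1 *: (g (h *: 1 + 0) - g 0)) @ 0^' --> l by rewrite -gl; exact: dg.
have /cvgrPdist_le/(_ _ l2)/nbhs_ballP[r2 r20 hr] := cg.
have m0 : 0 < Num.min r1 r2 by rewrite lt_min r10.
pose s := Num.min r1 r2 / (2 * `|l|); have s0 : 0 < s by rewrite divr_gt0 ?mulr_gt0.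
(* A step against the sign of l. *)
pose h := - (s * l).
have hlt : `|h| < Num.min r1 r2.
  rewrite normrN normrM (gtr0_norm s0) /s invfM mulrA mulfVK ?gt_eqF //.
  by rewrite ltr_pdivrMr // ltr_pMr // ltr1n.
move: hlt; rewrite lt_min => /andP[h1 h2].
have h0 : h != 0 by rewrite oppr_eq0 mulf_neq0 // gt_eqF.
have gm : g 0 <= g h by apply: gmin; rewrite /ball /= sub0r normrN.
have : `|l - h^-1 *: (g (h *: 1 + 0) - g 0)| <= `|l| / 2.
  by apply: hr; [rewrite /ball /= sub0r normrN|].
rewrite addr0 [h *: 1]mulr1; set q := h^-1 *: _.
have lq : l * q <= 0.
  have -> : l * q = - (g h - g 0) / s.
    rewrite /q /GRing.scale /= /h; field; rewrite l0 gt_eqF //.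
  by rewrite mulNr oppr_le0 divr_ge0 ?subr_ge0 // ltW.
case: (ltgtP l 0) l0 => // ls _.
  rewrite (ltr0_norm ls) ler_norml => /andP[a1 a2].
  have : 0 <= q by rewrite -(nmulr_rle0 _ ls).
  lra.
rewrite (gtr0_norm ls) ler_norml => /andP[a1 a2].
have : q <= 0 by rewrite -(pmulr_rle0 _ ls).
lra.
Qed.

Section SquaredDistance.
Context {R : realType} {n : nat}.
Implicit Types (x p u w : 'rV[R]_n).

Lemma frechet_sqr_dist x p :
  frechet (fun u => dot (x - u) (x - u)) p (dot^~ (- 2 *: (x - p))).
Proof.
move=> e e0; have n1 : 0 < n%:R + 1 :> R by rewrite ltr_wpDl.
apply/near_rowP; exists (e / (n%:R + 1)) => [|u]; first by rewrite divr_gt0.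
rewrite ltr_pdivlMr // => ud.
have -> : x - u = (x - p) - (u - p) by rewrite opprB addrA subrK.
have -> : dot (x - p - (u - p)) (x - p - (u - p)) - dot (x - p) (x - p) -
  dot (u - p) (- 2 *: (x - p)) = dot (u - p) (u - p).
  rewrite dotZr (dotBl (x - p)) !(dotBr (x - p)) (dotC (x - p) (u - p)); ring.
apply: le_trans (norm_dot_le _ _) _; rewrite ler_wpM2r //.
by apply: le_trans (ltW ud); rewrite mulrC ler_wpM2l // lerDl.
Qed.

End SquaredDistance.

Section EuclideanDistance.
Context {R : realType} {n : nat}.
Variables (k : nat) (alpha : R) (U V : set 'rV[R]_n) (Phi : 'rV[R]_n -> R).
Variable b : 'rV[R]_n.
Hypothesis ld : local_defining k.+2 alpha U V Phi.
Hypothesis alpha_le1 : alpha <= 1.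
Hypothesis U_bounded : bounded_set U.
Hypotheses (Vb : V b) (bb : boundary U b).
Implicit Types (x p u v w q : 'rV[R]_n).

Local Notation m := (unormal Phi).

Let V_open : open V := ld_open ld.

Lemma unormal_strict_jac p : V p -> strict_jac m p (jac m p).
Proof.
move=> Vp; apply: strict_jac_of_entries => j.
exact: Ckalpha_strict_grad V_open (unormal_regular alpha_le1 ld j) Vp.
Qed.

Lemma unormal_continuous p : V p -> {for p, continuous m}.
Proof.
move=> Vp; apply: row_continuous => i.
exact: Ckalpha_continuous (unormal_regular alpha_le1 ld i) Vp.
Qed.

Lemma jac_unormal_continuous p i j : V p -> {for p, continuous (fun p => jac m p i j)}.
Proof.
move=> Vp; have [_ /(_ i)[_ h]] := unormal_regular alpha_le1 ld j.
have -> : (fun p => jac m p i j) = (fun p => 'D_(delta_mx 0 i) (fun u => m u 0 j) p).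
  by apply/funext => q; rewrite mxE.
exact: Ckalpha_continuous h Vp.
Qed.

Lemma unormal_unit p : V p -> dot (m p) (m p) = 1.
Proof.
by move=> Vp; rewrite -sqr_enorm enorm_unormal ?expr1n //; exact: ld_grad ld _ Vp.
Qed.

Lemma norm_unormal_le1 p : V p -> `|m p| <= 1.
Proof.
move=> Vp; apply: le_trans (norm_le_enorm _) _.
by rewrite enorm_unormal //; exact: ld_grad ld _ Vp.
Qed.

Lemma grad_unormal p : V p -> grad Phi p = enorm (grad Phi p) *: m p.
Proof.
move=> Vp; have := enorm_gt0 (ld_grad ld Vp) => N0.
by rewrite /unormal scalerA mulfV ?gt_eqF // scale1r.
Qed.

(** Along a curve in the boundary with velocity [w] at [p] the squared distance to [x]
    is minimal at [p]. *)
Lemma closest_orthogonal x p w : V p -> boundary U p ->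
  (forall q, boundary U q -> enorm (x - p) <= enorm (x - q)) ->
  dot w (grad Phi p) = 0 -> dot w (x - p) = 0.
Proof.
move=> Vp bp pmin wN; have [c [c0 cb] dc] := ld_curve ld Vp bp wN.
have [dF FE] := frechet_dot_is_diff (@frechet_sqr_dist _ _ x p).
have [dc1 cE] := dc.
have dcc : differentiable c 0 by exact/derivable1_diffP.
have dFc : is_derive (0 : R) 1 ((fun u => dot (x - u) (x - u)) \o c)
    (dot w (- 2 *: (x - p))).
  rewrite -c0 in dF FE *; split; first by apply/derivable1_diffP; exact: differentiable_comp.
  rewrite deriveE; last exact: differentiable_comp.
  by rewrite diff_comp //= FE -deriveE // cE.
have : dot w (- 2 *: (x - p)) = 0.
  apply: derive_at_local_min dFc _; apply: filterS cb => t ct /=.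
  rewrite c0 -!sqr_enorm ler_sqr ?nnegrE ?enorm_ge0 //.
  exact: pmin.
by rewrite dotZr => /eqP; rewrite mulf_eq0 oppr_eq0 pnatr_eq0 /= => /eqP.
Qed.

Lemma closest_along_normal x p : V p -> boundary U p ->
  (forall q, boundary U q -> enorm (x - p) <= enorm (x - q)) ->
  x - p = dot (x - p) (m p) *: m p.
Proof.
move=> Vp bp pmin; set a := dot _ _; pose w := x - p - a *: m p.
have wm : dot w (m p) = 0 by rewrite dotBl dotZl unormal_unit // mulr1 subrr.
have wx : dot w (x - p) = 0.
  by apply: closest_orthogonal => //; rewrite grad_unormal // dotZr wm mulr0.
apply/eqP; rewrite -subr_eq0; apply/eqP/dot_eq0; rewrite -/w.
by rewrite {2}/w dotBr dotZr wm mulr0 subr0.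
Qed.

Let bd_compact : compact (boundary U) := boundary_compact U_bounded.

Let bd_nonempty : boundary U !=set0.
Proof. by exists b. Qed.

Let enorm_lip x y : enorm x <= enorm y + n%:R * `|x - y|.
Proof.
have := enormD y (x - y); rewrite addrC subrK => /le_trans; apply.
by rewrite lerD2l enorm_le.
Qed.

Lemma edist_lip x u : `|edist U x - edist U u| <= n%:R * `|x - u|.
Proof. exact: (qdist_lip enorm_ge0 (ler0n _ _) enorm_lip bd_compact bd_nonempty). Qed.

Lemma edist_le x q : boundary U q -> edist U x <= enorm (x - q).
Proof. exact: (qdist_le enorm_ge0). Qed.

(** By [closest_along_normal] the vector x - p is a multiple of the normal, of length
    [edist U x]. With a negative factor the expansion of [Phi] at [b] would make
    [Phi x] negative, but [x] lies in [U]. *)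
Lemma edist_foot : exists2 r : R, 0 < r & forall x p, U x -> `|x - b| < r ->
  boundary U p -> edist U x = enorm (x - p) -> x - p = edist U x *: m p.
Proof.
set g := grad Phi b; have g0 : 0 < enorm g by exact: enorm_gt0 (ld_grad ld Vb).
have e0 : 0 < enorm g / 4 by rewrite divr_gt0.
have [d1 d10 dP] := ld_strict_grad ld Vb e0; have [d2 d20 dV] := ld_ball ld Vb.
have mg : dot (m b) g = enorm g.
  by rewrite /g grad_unormal // dotZr unormal_unit // mulr1 enormZ enorm_unormal
    ?mulr1 ?ger0_norm ?enorm_ge0 //; exact: ld_grad ld _ Vb.
have e1 : 0 < enorm g / 2 / (n%:R * `|g| + 1).
  by rewrite !divr_gt0 // ltr_wpDl // mulr_ge0.
have /continuous_rowP/(_ _ e1)[d3 d30 dm] := unormal_continuous Vb.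
pose D := Num.min (Num.min d1 d2) d3.
have D0 : 0 < D by rewrite !lt_min d10 d20.
have n1 : 0 < n%:R + 1 :> R by rewrite ltr_wpDl.
exists (D / (n%:R + 1)); first by rewrite divr_gt0.
move=> x p Ux; rewrite ltr_pdivlMr // => xb bp pE.
have xbD : `|x - b| < D.
  by apply: le_lt_trans xb; rewrite ler_peMr // lerDr.
have pbD : `|p - b| < D.
  apply: le_lt_trans xb; rewrite -[p](subrK x) -addrA (le_trans (ler_normD _ _)) //.
  rewrite mulrDr mulr1 lerD2r distrC (le_trans (norm_le_enorm _)) // -pE.
  by rewrite (le_trans (edist_le _ bb)) // mulrC enorm_le.
move: xbD pbD; rewrite !lt_min => /andP[/andP[x1 x2] x3] /andP[/andP[p1 p2] p3].
have Vp := dV p p2; have Vx := dV x x2.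
have pmin q : boundary U q -> enorm (x - p) <= enorm (x - q).
  by move=> bq; rewrite -pE edist_le.
have xpE := closest_along_normal Vp bp pmin.
set a := dot (x - p) (m p) in xpE.
have aE : `|a| = edist U x.
  by rewrite pE xpE enormZ enorm_unormal ?mulr1 //; exact: ld_grad ld _ Vp.
suff a0 : 0 <= a by rewrite {1}xpE -aE ger0_norm.
rewrite leNgt; apply/negP => a_lt0.
have := dP x p x1 p1; rewrite ((ld_boundary ld Vp).1 bp) subr0 -/g.
have Px : 0 < Phi x by exact: (ld_in ld Vx).1 Ux.
have xpa : `|x - p| <= - a.
  by rewrite -(ltr0_norm a_lt0) aE pE norm_le_enorm.
have mp : enorm g / 2 <= dot (m p) g.
  have : `|dot (m p - m b) g| <= enorm g / 2.
    rewrite (le_trans (norm_dot_le _ _)) // mulrAC mulrC.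
    rewrite (le_trans (ler_wpM2r _ (dm p p3))) ?mulr_ge0 //.
    rewrite mulrAC ler_pdivrMr; last by rewrite ltr_wpDl // mulr_ge0.
    by rewrite ler_wpM2l ?lerDl // ltW // divr_gt0.
  by rewrite dotBl mg ler_norml => /andP[]; lra.
rewrite {1}xpE dotZl ler_norml => /andP[_ h].
have h1 : enorm g / 4 * `|x - p| <= enorm g / 4 * - a by rewrite ler_wpM2l // ltW.
have h2 : a * dot (m p) g <= a * (enorm g / 2) by rewrite ler_wnM2l // ltW.
have h3 : a * enorm g < 0 by rewrite nmulr_rlt0.
move: h h1 h2 h3 Px; set A := a * dot _ _; set B := _ * `|_|; set P := Phi x; lra.
Qed.

End EuclideanDistance.

(** The difference of x = p + s M and u = q + t N. *)
Lemma foot_increment {R : realType} {n : nat} (x u p q M N : 'rV[R]_n) (s t : R) :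
  x - p = s *: M -> u - q = t *: N ->
  u - x = (q - p) + t *: (N - M) + (t - s) *: M.
Proof.
move=> /rowP xE /rowP uE; apply/rowP => i.
by move: (xE i) (uE i); rewrite !mxE; lra.
Qed.

(** On the right, with [h] the increment of [x], [s] that of the foot, [N] the normal at
    the new foot and [Q] the Jacobian of the normal, every term is o(h): the first by
    the expansion of the normal, the second because it is quadratic, the third by the
    expansion of the distance. So the left side determines the Jacobian of the foot
    map. *)
Lemma foot_residual {R : realType} {n : nat} (h s M N : 'rV[R]_n) (t d : R) (Q : 'M[R]_n) :
  h = s + t *: (N - M) + (t - d) *: M ->
  h *m (1%:M - M^T *m M) - s *m (1%:M + d *: Q) =
  d *: (N - M - s *m Q) + (t - d) *: (N - M) + (t - d - dot h M) *: M.
Proof.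
move=> hE; rewrite mulmxBr mulmx1 mul_outer mulmxDr mulmx1 -scalemxAr.
move: (dot h M) (s *m Q) => a q; rewrite hE.
by apply/rowP => i; rewrite !mxE; ring.
Qed.

Section Foot.
Context {R : realType} {n : nat}.
Variables (k : nat) (alpha : R) (U V : set 'rV[R]_n) (Phi : 'rV[R]_n -> R).
Variable b : 'rV[R]_n.
Hypothesis ld : local_defining k.+2 alpha U V Phi.
Hypothesis alpha_le1 : alpha <= 1.
Hypothesis U_bounded : bounded_set U.
Hypotheses (Vb : V b) (bb : boundary U b).
Implicit Types (x p u v w q : 'rV[R]_n).

Local Notation m := (unormal Phi).

(** A choice [p] of Euclidean closest points inside [U] near [b], with the bounds used
    to differentiate it. *)
Record foot_map (r l : R) (p : 'rV[R]_n -> 'rV[R]_n) : Prop := {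
  foot_V : forall x, U x -> `|x - b| < r -> V (p x);
  foot_boundary : forall x, U x -> `|x - b| < r -> boundary U (p x);
  foot_near : forall x, U x -> `|x - b| < r -> `|p x - b| <= (n%:R + 1) * `|x - b|;
  foot_dist : forall x, U x -> `|x - b| < r -> 0 <= edist U x <= 1;
  foot_eq : forall x, U x -> `|x - b| < r -> x - p x = edist U x *: m (p x);
  foot_lip : forall x u, U x -> `|x - b| < r -> U u -> `|u - b| < r ->
    `|p x - p u| <= 2 * (n%:R + 1) * `|x - u|;
  foot_normal_lip : forall x u, U x -> `|x - b| < r -> U u -> `|u - b| < r ->
    `|m (p x) - m (p u)| <= l * `|p x - p u| }.

(** In the Lipschitz bound for [p], two feet differ by x - u, a change of length along
    the normal, which is Lipschitz in [x], and edist U x (m (p x) - m (p u)). The last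
    term is at most half of |p x - p u| once the distance is small. *)
Lemma foot_map_exists : exists (r l : R) (p : 'rV[R]_n -> 'rV[R]_n),
  [/\ 0 < r, 0 <= l & foot_map r l p].
Proof.
have [r1 r10 foot] := edist_foot ld alpha_le1 Vb bb.
have [l l0 [r2 r20 mlip]] := strict_jac_lip (unormal_strict_jac ld alpha_le1 Vb).
have [r3 r30 rV] := ld_ball ld Vb.
have n1 : 0 < n%:R + 1 :> R by rewrite ltr_wpDl.
have enorm_lip (x y : 'rV[R]_n) : enorm x <= enorm y + n%:R * `|x - y|.
  have := enormD y (x - y); rewrite addrC subrK => /le_trans; apply.
  by rewrite lerD2l enorm_le.
have bd_nonempty : boundary U !=set0 by exists b.
have /choice[p pP] : forall x, exists p, boundary U p /\ edist U x = enorm (x - p).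
  move=> x; have [p bp pE] := qdist_attained enorm_ge0 (ler0n R n) enorm_lip
    (boundary_compact U_bounded) bd_nonempty x.
  by exists p.
(* The last bound makes [edist U x * l] at most 1/2. *)
pose D := Num.min (Num.min r2 r3) (Num.min 1 (1 / (2 * l))).
have D0 : 0 < D by rewrite !lt_min r20 r30 ltr01 divr_gt0 // mulr_gt0.
have near x : U x -> `|p x - b| <= (n%:R + 1) * `|x - b|.
  move=> Ux; rewrite -[p x](subrK x) -addrA (le_trans (ler_normD _ _)) //.
  rewrite mulrDl mul1r lerD2r distrC (le_trans (norm_le_enorm _)) // -(pP x).2.
  by rewrite (le_trans (edist_le _ bb)) // enorm_le.
have dist x : edist U x <= n%:R * `|x - b|.
  by rewrite (le_trans (edist_le _ bb)) // enorm_le.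
have dist0 x : 0 <= edist U x by rewrite (pP x).2 enorm_ge0.
pose r := Num.min r1 (D / (n%:R + 1)).
have rD x : `|x - b| < r -> (n%:R + 1) * `|x - b| < D.
  by rewrite lt_min => /andP[_]; rewrite ltr_pdivlMr // mulrC.
have rdist x : `|x - b| < r -> edist U x < D.
  move=> /rD; apply: le_lt_trans; apply: le_trans (dist x) _.
  by rewrite ler_wpM2r // lerDl.
have p2 x : U x -> `|x - b| < r -> `|p x - b| < r2.
  by move=> Ux /rD /(le_lt_trans (near x Ux)); rewrite !lt_min => /andP[/andP[]].
have p3 x : U x -> `|x - b| < r -> V (p x).
  by move=> Ux /rD /(le_lt_trans (near x Ux)); rewrite !lt_min => /andP[/andP[_ /rV]].
have feq x : U x -> `|x - b| < r -> x - p x = edist U x *: m (p x).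
  move=> Ux xr; apply: foot => //; [|exact: (pP x).1|exact: (pP x).2].
  by move: xr; rewrite lt_min => /andP[].
exists r, l, p; split; [by rewrite lt_min r10 divr_gt0|exact: ltW|].
split=> //.
- by move=> x _ _; exact: (pP x).1.
- by move=> x Ux _; exact: near.
- move=> x Ux /rdist; rewrite !lt_min dist0 => /andP[_ /andP[/ltW]] //.
- move=> x u Ux xr Uu ur.
  have E : p x - p u = (x - u) - edist U x *: (m (p x) - m (p u))
      - (edist U x - edist U u) *: m (p u).
    rewrite (foot_increment (feq u Uu ur) (feq x Ux xr)).
    by rewrite [RHS]addrAC !addrK.
  have h1 : `|edist U x *: (m (p x) - m (p u))| <= 1 / 2 * `|p x - p u|.
    rewrite normrZ ger0_norm //.
    apply: le_trans (ler_wpM2l (dist0 x) (mlip _ _ (p2 x Ux xr) (p2 u Uu ur))) _.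
    rewrite mulrA ler_wpM2r // -ler_pdivlMr // ltW //.
    have := rdist x xr; rewrite !lt_min => /andP[_ /andP[_]].
    by rewrite invfM mulrA.
  have h2 : `|(edist U x - edist U u) *: m (p u)| <= n%:R * `|x - u|.
    rewrite normrZ -[leRHS]mulr1 ler_pM //; last exact: (norm_unormal_le1 ld (p3 u Uu ur)).
    exact: (edist_lip U_bounded bb).
  have : `|p x - p u| <= `|x - u| + 1 / 2 * `|p x - p u| + n%:R * `|x - u|.
    rewrite {1}E (le_trans (ler_normB _ _)) // lerD //.
    by rewrite (le_trans (ler_normB _ _)) // lerD2l.
  by move: (`|p x - p u|) (`|x - u|) => s t; lra.
- by move=> x u Ux xr Uu ur; apply: mlip; exact: p2.
Qed.

Variables (r l : R) (p : 'rV[R]_n -> 'rV[R]_n).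
Hypotheses (l_ge0 : 0 <= l) (fm : foot_map r l p).

Hypothesis U_open : open U.

Let D := U `&` [set x | `|x - b| < r].

Let D_open : open D.
Proof.
by apply: openI => //; exact: open_row_ball.
Qed.

Let nbhs_D x : D x -> exists2 d : R, 0 < d & forall u, `|u - x| < d -> D u.
Proof. by move=> Dx; apply/near_rowP; exact: open_nbhs_nbhs. Qed.

Let c : R := 2 * (n%:R + 1).

Let c_gt0 : 0 < c.
Proof. by rewrite mulr_gt0 // ltr_wpDl. Qed.

Let small_of_quadratic {W : normedModType R} (f : 'rV[R]_n -> W) x (C : R) : 0 <= C -> D x ->
  (forall u, D u -> `|f u| <= C * (`|u - x| * `|u - x|)) -> small_at x f.
Proof.
move=> C0 Dx fC e e0; have [d d0 dD] := nbhs_D Dx.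
have C1 : 0 < C + 1 by rewrite ltr_wpDl.
apply/near_rowP; exists (Num.min d (e / (C + 1))).
  by rewrite lt_min d0 divr_gt0.
move=> u; rewrite lt_min => /andP[/dD Du]; rewrite ltr_pdivlMr // => ue.
apply: le_trans (fC u Du) _; rewrite mulrA ler_wpM2r //.
by apply: le_trans (ltW ue); rewrite mulrC ler_wpM2l // lerDl.
Qed.

(** Take the inner product of [foot_increment] with m (p x). The chord p u - p x is
    tangent up to o(u - x), and as both normals have length 1 the product
    <m (p u) - m (p x), m (p x)> is quadratic in their difference. *)
Lemma edist_frechet x : D x -> frechet (edist U) x (dot^~ (m (p x))).
Proof.
move=> Dx; have [Ux xr] := Dx; have Vp := foot_V fm Ux xr; have bp := foot_boundary fm Ux xr.
pose s1 u := - dot (p u - p x) (m (p x)).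
pose s2 u := - (edist U u * dot (m (p u) - m (p x)) (m (p x))).
have s1_small : small_at x s1.
  move=> e e0; have N0 := enorm_gt0 (ld_grad ld Vp).
  have e'0 : 0 < e * enorm (grad Phi (p x)) / c by rewrite divr_gt0 // mulr_gt0.
  have [d d0 dP] := ld_strict_grad ld Vp e'0; have [d' d'0 dD] := nbhs_D Dx.
  apply/near_rowP; exists (Num.min d' (d / c)); first by rewrite lt_min d'0 divr_gt0.
  move=> u; rewrite lt_min => /andP[/dD [Uu ur]]; rewrite ltr_pdivlMr // mulrC => uc.
  have pl := foot_lip fm Uu ur Ux xr; rewrite -/c in pl.
  have := dP (p u) (p x) (le_lt_trans pl uc); rewrite subrr normr0 => /(_ d0).
  rewrite ((ld_boundary ld (foot_V fm Uu ur)).1 (foot_boundary fm Uu ur)).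
  rewrite ((ld_boundary ld Vp).1 bp) subrr sub0r normrN.
  rewrite {1}(grad_unormal ld Vp) dotZr normrM ger0_norm ?enorm_ge0 // => h.
  rewrite /s1 normrN -(ler_pM2l N0); apply: le_trans h _.
  apply: le_trans (ler_wpM2l (ltW e'0) pl) _.
  rewrite [leLHS](_ : _ = enorm (grad Phi (p x)) * (e * `|u - x|)) //.
  by field; rewrite gt_eqF.
have s2_small : small_at x s2.
  apply: (@small_of_quadratic R s2 x (n%:R / 2 * (l * c) ^+ 2)) => //.
    by rewrite mulr_ge0 ?divr_ge0 ?sqr_ge0.
  move=> u [Uu ur]; rewrite /s2 normrN normrM.
  have /andP[d0 d1] := foot_dist fm Uu ur; rewrite (ger0_norm d0).
  have E : dot (m (p u) - m (p x)) (m (p x)) =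
      - (dot (m (p u) - m (p x)) (m (p u) - m (p x)) / 2).
    have := unormal_unit ld Vp; have := unormal_unit ld (foot_V fm Uu ur).
    move: (m (p u)) (m (p x)) => a a' aa aa'.
    by rewrite !dotBr !dotBl (dotC a' a); lra.
  rewrite E normrN (le_trans (ler_piMl _ d1)) // normrM.
  have ml : `|m (p u) - m (p x)| <= l * c * `|u - x|.
    apply: le_trans (foot_normal_lip fm Uu ur Ux xr) _.
    by rewrite -mulrA ler_wpM2l // (foot_lip fm).
  rewrite (ger0_norm (_ : 0 <= 2^-1)) ?invr_ge0 //.
  have h1 := norm_dot_le (m (p u) - m (p x)) (m (p u) - m (p x)).
  have h2 : n%:R * `|m (p u) - m (p x)| * `|m (p u) - m (p x)| <=
      n%:R * (l * c * `|u - x|) * (l * c * `|u - x|).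
    by rewrite ler_pM ?ler_wpM2l // mulr_ge0.
  have -> : n%:R / 2 * (l * c) ^+ 2 * (`|u - x| * `|u - x|) =
      n%:R * (l * c * `|u - x|) * (l * c * `|u - x|) / 2 by field.
  by rewrite ler_wpM2r ?invr_ge0 // (le_trans h1 h2).
have := small_atD s1_small s2_small; apply: small_at_eq.
have [d d0 dD] := nbhs_D Dx; apply/near_rowP; exists d => // u /dD[Uu ur].
have h : u - x = (p u - p x) + edist U u *: (m (p u) - m (p x)) +
    (edist U u - edist U x) *: m (p x).
  exact: foot_increment (foot_eq fm Ux xr) (foot_eq fm Uu ur).
rewrite h 2!dotDl 2!dotZl (unormal_unit ld Vp) mulr1 /s1 /s2.
by set a := dot _ _; set a' := edist U u * _; set d1 := edist U u; set d2 := edist U x; ring.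
Qed.


(** The Jacobian of [m \o p], acting on rows. *)
Definition foot_jac (x : 'rV[R]_n) : 'M[R]_n :=
  (1%:M - (m (p x))^T *m m (p x)) *m
    invmx (1%:M + edist U x *: jac m (p x)) *m jac m (p x).

(** By [foot_residual] the increment of [p] solves a linear system with matrix
    1 + d Dm up to o(u - x). *)
Lemma foot_is_diff x : D x -> \det (1%:M + edist U x *: jac m (p x)) != 0 ->
  is_diff x p (mulmxr ((1%:M - (m (p x))^T *m m (p x)) *m
    invmx (1%:M + edist U x *: jac m (p x)))).
Proof.
move=> Dx; have [Ux xr] := Dx; have Vp := foot_V fm Ux xr.
set Q := jac m (p x); set d := edist U x; set M := m (p x); set B := 1%:M + d *: Q.
set P := 1%:M - M^T *m M => B0; have B_unit : B \in unitmx by rewrite unitmxE unitfE.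
pose r1 u := m (p u) - M - (p u - p x) *m Q.
pose r2 u := edist U u - d - dot (u - x) M.
have r1_small : small_at x r1.
  move=> e e0; have ec : 0 < e / c by rewrite divr_gt0.
  have [d1 d10 dP] := unormal_strict_jac ld alpha_le1 Vp ec; have [d2 d20 dD] := nbhs_D Dx.
  apply/near_rowP; exists (Num.min d2 (d1 / c)); first by rewrite lt_min d20 divr_gt0.
  move=> u; rewrite lt_min => /andP[/dD [Uu ur]]; rewrite ltr_pdivlMr // mulrC => uc.
  have pl := foot_lip fm Uu ur Ux xr; rewrite -/c in pl.
  have := dP (p u) (p x) (le_lt_trans pl uc); rewrite subrr normr0 => /(_ d10) h.
  apply: le_trans h _; apply: le_trans (ler_wpM2l (ltW ec) pl) _.
  by rewrite mulrA divfK // gt_eqF.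
have r2_small : small_at x r2 := edist_frechet Dx.
have s1 : small_at x (fun u => d *: r1 u).
  by apply: (small_at_le (normr_ge0 d) _ r1_small) => u; rewrite normrZ.
have s3 : small_at x (fun u => r2 u *: M).
  by apply: (small_at_le (normr_ge0 M) _ r2_small) => u; rewrite normrZ mulrC.
have s2 : small_at x (fun u => (edist U u - d) *: (m (p u) - M)).
  apply: (@small_of_quadratic _ _ x (n%:R * (l * c))) => //.
    by rewrite !mulr_ge0 // ltW.
  move=> u [Uu ur]; rewrite normrZ mulrACA ler_pM //.
    exact: (edist_lip U_bounded bb).
  apply: le_trans (foot_normal_lip fm Uu ur Ux xr) _.
  by rewrite -mulrA ler_wpM2l // (foot_lip fm).
have T_small : small_at x (fun u => (u - x) *m P - (p u - p x) *m B).
  have := small_atD (small_atD s1 s2) s3; apply: small_at_eq.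
  have [d' d'0 dD] := nbhs_D Dx; apply/near_rowP; exists d' => // u /dD[Uu ur].
  have h := foot_increment (foot_eq fm Ux xr) (foot_eq fm Uu ur).
  exact: esym (foot_residual Q h).
have [c' c'0 Bc] := mulmx_lip (invmx B).
apply: frechet_is_diff => /=.
have := small_atN (_ : small_at x (fun u => ((u - x) *m P - (p u - p x) *m B) *m invmx B)).
move=> H; suff : small_at x (fun u => - (((u - x) *m P - (p u - p x) *m B) *m invmx B)).
  apply: small_at_eq; apply: filterE => u /=.
  by rewrite mulmxBl mulmxK // -mulmxA opprB.
by apply: H; apply: (small_at_le c'0 _ T_small) => u; exact: Bc.
Qed.

Lemma unormal_foot_is_diff x : D x -> \det (1%:M + edist U x *: jac m (p x)) != 0 ->
  is_diff x (m \o p) (mulmxr (foot_jac x)).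
Proof.
move=> Dx B0; have [Ux xr] := Dx; have Vp := foot_V fm Ux xr.
have hp := foot_is_diff Dx B0.
have hm := frechet_is_diff (strict_jac_frechet (unormal_strict_jac ld alpha_le1 Vp)).
apply: is_diff_eq (is_diff_comp hp hm) _.
by apply/funext => v /=; rewrite /foot_jac !mulmxA.
Qed.

(** Applied at points of [U] for the continuity of the Hessian, and at [b] from inside
    [U] for its boundary value. *)
Lemma foot_jac_cvg (F : set_system 'rV[R]_n) {FF : Filter F} (t : R) q :
  edist U x @[x --> F] --> t -> p x @[x --> F] --> q -> V q ->
  \det (1%:M + t *: jac m q) != 0 ->
  (\forall x \near F, \det (1%:M + edist U x *: jac m (p x)) != 0) /\
  entry_cvg (F := F) foot_jac
    ((1%:M - (m q)^T *m m q) *m invmx (1%:M + t *: jac m q) *m jac m q).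
Proof.
move=> dt pq Vq B0.
have mq : entry_cvg (F := F) (fun x => m (p x)) (m q).
  move=> i j; rewrite (ord1 i).
  have h := Ckalpha_continuous (unormal_regular alpha_le1 ld j) Vq.
  exact: (cvg_comp p (fun q => m q 0 j) pq h).
have jq : entry_cvg (F := F) (fun x => jac m (p x)) (jac m q).
  move=> i j; have h := jac_unormal_continuous ld alpha_le1 (i := i) (j := j) Vq.
  exact: (cvg_comp p (fun q => jac m q i j) pq h).
have one : entry_cvg (F := F) (fun _ => 1%:M : 'M[R]_n) 1%:M by exact: entry_cvg_cst.
have Bq : entry_cvg (F := F) (fun x => 1%:M + edist U x *: jac m (p x)) (1%:M + t *: jac m q).
  exact: (entry_cvgD one (entry_cvgZ dt jq)).
split; first exact: (cvgr_neq0 (\det (1%:M + t *: jac m q)) (entry_cvg_det Bq) B0).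
apply: entry_cvgM jq; apply: entry_cvgM (entry_cvg_inv Bq B0).
have NE : entry_cvg (F := F) (fun x => - ((m (p x))^T *m m (p x))) (- ((m q)^T *m m q)).
  have -> : (fun x => - ((m (p x))^T *m m (p x))) =
      (fun x => - 1 *: ((m (p x))^T *m m (p x))).
    by apply/funext => x; rewrite scaleN1r.
  have c1 : (fun _ : 'rV[R]_n => - 1 : R) x @[x --> F] --> (- 1 : R) by exact: cvg_cst.
  by rewrite -[X in entry_cvg _ X]scaleN1r; exact: (entry_cvgZ c1 (entry_cvgM (entry_cvg_tr mq) mq)).
exact: (entry_cvgD one NE).
Qed.

End Foot.

Lemma foot_jac_boundary {R : realType} {n : nat} (M : 'rV[R]_n) (Q : 'M[R]_n) :
  ((1%:M - M^T *m M) *m invmx (1%:M + 0 *: Q) *m Q)^T = Q^T *m (1%:M - M^T *m M).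
Proof.
rewrite scale0r addr0 invmx1 mulmx1 trmx_mul; congr (_ *m _).
by rewrite raddfB /= trmx1 trmx_mul trmxK.
Qed.

(** At the boundary the distance is 0, so the inverse matrix in [foot_jac] tends to 1. *)
Lemma edist_hessian {R : realType} {n : nat} (k : nat) (alpha : R)
    (U V : set 'rV[R]_n) (Phi : 'rV[R]_n -> R) (b : 'rV[R]_n) :
  local_defining k.+2 alpha U V Phi -> alpha <= 1 -> open U -> bounded_set U ->
  V b -> boundary U b ->
  hessian_from_inside U (edist U) b
    ((jac (unormal Phi) b)^T *m (1%:M - (unormal Phi b)^T *m unormal Phi b)).
Proof.
move=> ld a1 oU bU Vb bb.
have [r [l [p [r0 l0 fm]]]] := foot_map_exists ld a1 bU Vb bb.
have edist_b : edist U b = 0.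
  apply/eqP; rewrite eq_le; have := edist_le b bb; rewrite subrr enorm0 => -> /=.
  by apply: (qdist_ge0 enorm_ge0); exists b.
have edist_cvg x : edist U u @[u --> x] --> edist U x.
  apply/continuous_rowP => e e0; have n1 : 0 < n%:R + 1 :> R by rewrite ltr_wpDl.
  exists (e / (n%:R + 1)) => [|u]; first by rewrite divr_gt0.
  rewrite ltr_pdivlMr // => ue; apply: le_trans (edist_lip bU bb u x) _.
  by apply: le_trans (ltW ue); rewrite mulrC ler_wpM2l // lerDl.
have edist_lim : edist U x @[x --> within U (nbhs b)] --> (0 : R).
  by rewrite -edist_b; apply: cvg_within_filter; exact: edist_cvg.
have p_lim : p x @[x --> within U (nbhs b)] --> b.
  apply/cvgrPdist_le => e e0; have n1 : 0 < n%:R + 1 :> R by rewrite ltr_wpDl.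
  have : \forall x \near b, U x -> `|b - p x| <= e; last by [].
  apply/near_rowP; exists (Num.min r (e / (n%:R + 1))).
    by rewrite lt_min r0 divr_gt0.
  move=> x; rewrite lt_min => /andP[xr]; rewrite ltr_pdivlMr // => xe Ux.
  rewrite distrC (le_trans (foot_near fm Ux xr)) // mulrC; exact: ltW.
have B1 : \det (1%:M + 0 *: jac (unormal Phi) b) != 0 :> R.
  by rewrite scale0r addr0 det1 oner_neq0.
have [detn cvgS] := foot_jac_cvg ld a1 edist_lim p_lim Vb B1.
have /near_rowP[r' r'0 detP] : \forall x \near b, U x ->
    \det (1%:M + edist U x *: jac (unormal Phi) (p x)) != 0 by exact: detn.
pose W := [set x | `|x - b| < Num.min r r'].
have oW : open W by exact: open_row_ball.
have Wb : W b by rewrite /W /= subrr normr0 lt_min r0.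
have UWr x : (U `&` W) x -> U x /\ `|x - b| < r.
  by move=> [Ux]; rewrite /W /= lt_min => /andP[].
have UWd x : (U `&` W) x -> \det (1%:M + edist U x *: jac (unormal Phi) (p x)) != 0.
  by move=> [Ux]; rewrite /W /= lt_min => /andP[_ /detP]; apply.
have oUW : open (U `&` W) by exact: openI.
have gradE x : (U `&` W) x -> frechet (edist U) x (dot^~ ((unormal Phi \o p) x)).
  by move=> /UWr Dx; exact: (edist_frechet ld l0 fm oU Dx).
have jacE x : (U `&` W) x -> is_diff x (unormal Phi \o p) (mulmxr (foot_jac U Phi p x)).
  by move=> Dx; exact: (unormal_foot_is_diff ld a1 bU bb l0 fm oU (UWr x Dx) (UWd x Dx)).
have jac_cvg x : (U `&` W) x -> entry_cvg (F := nbhs x) (foot_jac U Phi p) (foot_jac U Phi p x).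
  move=> Dx; have [Ux xr] := UWr x Dx.
  have px : p u @[u --> x] --> p x.
    by apply: differentiable_continuous;
       have [] := foot_is_diff ld a1 bU bb l0 fm oU (UWr x Dx) (UWd x Dx).
  exact: (foot_jac_cvg ld a1 (edist_cvg x) px (foot_V fm Ux xr) (UWd x Dx)).2.
have [C2 hessE] := C2_of_gradient oUW gradE jacE jac_cvg.
split; first by exists W; split.
have hS : entry_cvg (F := within U (nbhs b)) (fun x => (foot_jac U Phi p x)^T)
    ((jac (unormal Phi) b)^T *m (1%:M - (unormal Phi b)^T *m unormal Phi b)).
  by rewrite -foot_jac_boundary; exact: (entry_cvg_tr cvgS).
apply: cvg_trans (entry_cvg_cvg hS); apply: near_eq_cvg.
have : nbhs b W by exact: open_nbhs_nbhs.
by apply: filterS => x Wx Ux; rewrite hessE.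
Qed.

(** * The Hessian of the distance, and the theorem *)

Section RayHessian.
Context {R : realType} {n : nat}.
Implicit Types (U V A : set 'rV[R]_n) (x p v z : 'rV[R]_n) (Phi : 'rV[R]_n -> R).

(** The quotient rule for m / <z, m>. *)
Lemma jac_ray_grad k alpha U V Phi z p :
  local_defining k.+2 alpha U V Phi -> alpha <= 1 -> V p ->
  dot z (unormal Phi p) != 0 ->
  jac (ray_grad Phi z) p = (dot z (unormal Phi p))^-1 *:
    (jac (unormal Phi) p *m
      (1%:M - (dot z (unormal Phi p))^-1 *: (z^T *m unormal Phi p))).
Proof.
move=> ld a1 Vp s0; set s := dot z _ in s0 *; set m := unormal Phi; set Q := jac m p.
have [dm mE] : is_diff p m (mulmxr Q).
  exact: frechet_is_diff (strict_jac_frechet (unormal_strict_jac ld a1 Vp)).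
have [ds sE] := is_diff_dot z (m p).
pose f q := dot (m q) z.
have df : differentiable f p by exact: (differentiable_comp dm ds).
have fE i : 'D_(delta_mx 0 i) f p = dot (row i Q) z.
  rewrite deriveE //.
  have -> : 'd f p = 'd ((fun q => dot q z) \o m) p :> (_ -> _) by [].
  by rewrite diff_comp //= sE mE /= -rowE.
have fs : f p = s by rewrite /f dotC.
have dmj j i : derivable (fun q => m q 0 j) p (delta_mx 0 i).
  by apply: (derivable_mxP _ _ _).1; exact: diff_derivable.
apply/matrixP => i j; rewrite [LHS]mxE.
have f0 : f p != 0 by rewrite fs.
have dfi : derivable f p (delta_mx 0 i) by exact: diff_derivable.
have di := derivableV f0 dfi.
have -> : (fun u => ray_grad Phi z u 0 j) = (fun q => (f q)^-1) * (fun q => m q 0 j).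
  by apply/funext => q; rewrite [LHS]mxE dotC.
rewrite (deriveM di (dmj j i)) (deriveV f0 dfi) fE fs.
have -> : 'D_(delta_mx 0 i) (fun q => m q 0 j) p = Q i j by rewrite [RHS]mxE.
have entryE (A B : 'M[R]_n) (a : R) : (a *: (A - a *: B)) i j = a * (A i j - a * B i j).
  by rewrite !mxE.
rewrite mulmxBr mulmx1 -scalemxAr entryE.
have -> : (Q *m (z^T *m m p)) i j = dot (row i Q) z * m p 0 j.
  have := row_mul i Q (z^T *m m p); rewrite mul_outer => /rowP/(_ j).
  by rewrite [LHS]mxE [RHS]mxE.
by rewrite /GRing.scale /=; field.
Qed.


(** Since m X = m, the row [m] is annihilated by 1 - X, so that
    (1 - m^T m) (1 - X) = 1 - X. *)
Lemma hessian_algebra (z m : 'rV[R]_n) (Q : 'M[R]_n) (X := (dot z m)^-1 *: (z^T *m m)) :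
  dot z m != 0 ->
  ((1%:M - X)^T *m ((dot z m)^-1 *: (Q *m (1%:M - X))))^T =
  (dot z m)^-1 *: ((1%:M - X^T) *m (Q^T *m (1%:M - m^T *m m)) *m (1%:M - X)).
Proof.
move=> s0; have mX : m *m X = m.
  by rewrite /X -scalemxAr mul_outer (dotC m) scalerA mulVf // scale1r.
have pX : (1%:M - m^T *m m) *m (1%:M - X) = 1%:M - X.
  rewrite mulmxBl mul1mx -mulmxA mulmxBr mulmx1 mX subrr mulmx0 subr0 //.
clearbody X; rewrite trmx_mul trmxK linearZ /= trmx_mul -!mulmxA pX -scalemxAl.
by rewrite [(1%:M - X)^T]raddfB /= trmx1 mulmxA.
Qed.

End RayHessian.

Theorem theorem1 (R : realType) (n : nat) (K U : set 'rV[R]_n)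
    (k : nat) (alpha : R) (nu : 'rV[R]_n -> 'rV[R]_n) (x0 y0 : 'rV[R]_n)
    (K_compact : compact K) (K_convex : convex_set K) (K_int0 : K° 0)
    (U_open : open U) (U_bounded : bounded_set U)
    (k_ge1 : (1 <= k)%N) (alpha_ge0 : 0 <= alpha) (alpha_le1 : alpha <= 1)
    (U_reg : Ckalpha_boundary k alpha U)
    (nu_normal : forall y, boundary U y -> inward_unit_normal U y (nu y))
    (x0U : U x0)
    (y0_closest : closest_point K U x0 y0)
    (y0_unique : forall y, closest_point K U x0 y -> y = y0)
    (nu0_int :
      (normal_cone K ((gauge_dist K U x0)^-1 *: (x0 - y0)))° (nu y0)) :
  exists (A : set 'rV[R]_n) (y : 'rV[R]_n -> 'rV[R]_n),
    (open A /\ A x0) /\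
    Ckalpha k alpha (gauge_dist K U) A /\
    (forall x, A x -> closest_point K U x (y x) /\
                      forall z, closest_point K U x z -> z = y x) /\
    (forall V : set 'rV[R]_n, nbhs y0 V -> \forall x \near x0, V (y x)) /\
    Ckalpha k alpha y A /\
    (forall x, A x ->
      let v := nu (y x) in
      let go := gauge (polar K) in
      [/\ differentiable (gauge_dist K U) x /\
            grad (gauge_dist K U) x = (go v)^-1 *: v,
          differentiable go v,
          differentiable y x /\ Dmx y x = 1%:M - Xmx K v &
          (2 <= k)%N ->
            exists H : 'M[R]_n,
              hessian_from_inside U (edist U) (y x) H /\
              hessian (gauge_dist K U) x =
                (go v)^-1 *: ((1%:M - (Xmx K v)^T) *m H *m (1%:M - Xmx K v))]).
Proof.
case: k k_ge1 U_reg => [//|k] _ U_reg.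
have by0 : boundary U y0 := y0_closest.1.
have [V0 [Phi [V0y0 ld0]]] := local_defining_function U_open alpha_le1 U_reg by0.
set z0 := closest_direction K U x0 y0.
have Kz0 : K z0 by exact: (closest_direction_in K_compact K_int0 U_open x0U y0_closest).
have nuE y : V0 y -> boundary U y -> nu y = unormal Phi y.
  by move=> V0y ybd; exact: (ld_normal ld0 V0y ybd (nu_normal _ ybd)).
have cone0 : (normal_cone K z0)° (unormal Phi y0) by rewrite -nuE.
have m_cont : {for y0, continuous (unormal Phi)}.
  apply: row_continuous => i.
  exact: Ckalpha_continuous (unormal_regular alpha_le1 ld0 i) V0y0.
(* On a small ball the extended normal stays interior to the normal cone at z0. *)
have /near_rowP[d d0 dP] : \forall p \near y0, V0 p /\ (normal_cone K z0)° (unormal Phi p).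
  have V0n : nbhs y0 V0 by apply: open_nbhs_nbhs; split => //; exact: ld_open ld0.
  have Cn : nbhs (unormal Phi y0) (normal_cone K z0)°.
    by apply: open_nbhs_nbhs; split => //; exact: open_interior.
  by apply: filterS2 V0n (m_cont _ Cn).
pose V := [set p | `|p - y0| < d].
have oV : open V by exact: open_row_ball.
have VV0 : V `<=` V0 by move=> p /dP[].
have ld : local_defining k.+1 alpha U V Phi := local_defining_subset oV VV0 ld0.
have m_cone p : V p -> (normal_cone K z0)° (unormal Phi p) by move=> /dP[].
have m1 p : V p -> enorm (unormal Phi p) = 1.
  by move=> Vp; apply: enorm_unormal; exact: (ld_grad ld Vp).
have transversal p : V p -> 0 < dot z0 (unormal Phi p).
  move=> Vp; apply: (dot_cone_gt0 K_int0); last exact: m1.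
  exact: interior_subset (m_cone p Vp).
have Vy0 : V y0 by rewrite /V /= subrr normr0.
have nearby (r : R) (r0 : 0 < r) := closest_point_near K_compact K_convex K_int0
  U_open U_bounded x0U y0_closest y0_unique ld Vy0 erefl cone0 r0.
have /near_rowP[e e0 eP] := nearby d d0.
pose A := [set x | `|x - x0| < e]; pose y := ray_foot K U x0 y0.
have oA : open A by exact: open_row_ball.
have [L L0 y_lip] := ray_foot_lip K_convex K_int0 U_bounded y0_closest.
have yV x : A x -> V (y x) by move=> /eP[].
have yb x : A x -> boundary U (y x) by move=> /eP[].
have rho_grad x : A x -> differentiable (gauge_dist K U) x /\
    grad (gauge_dist K U) x = ray_grad Phi z0 (y x).
  exact: (ray_grad_rho ld transversal oA L0 y_lip yV yb).
(* The polar gauge is linear near each normal, hence differentiable with gradient z0. *)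
have goE p : V p -> \forall v \near unormal Phi p, gauge (polar K) v = dot v z0.
  move=> Vp; have zm := transversal p Vp; rewrite dotC in zm.
  have z2 : 0 < dot (unormal Phi p) z0 / 2 by rewrite divr_gt0.
  have [dz _] := is_diff_dot z0 (unormal Phi p).
  have /continuous_rowP/(_ _ z2)/near_rowP zn := differentiable_continuous dz.
  apply: filterS2 zn (m_cone p Vp) => w zw Nw.
  rewrite (gauge_polar_normal_cone Kz0 Nw) dotC //.
  by move: zw; rewrite ler_norml => /andP[]; lra.
exists A, y; split; [|split; [|split; [|split; [|split]]]].
- by split => //; rewrite /A /= subrr normr0.
- exact: (ray_rho_regular ld alpha_ge0 alpha_le1 transversal oA L0 y_lip yV yb).
- by move=> x /eP[].
- move=> W /near_rowP[r r0 rW]; have := nearby r r0; apply: filterS => x [_ yr _ _].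
  exact: rW.
- exact: (ray_y_regular ld alpha_ge0 alpha_le1 transversal oA L0 y_lip yV yb).
move=> x Ax v go; have Vyx := yV x Ax.
have vE : v = unormal Phi (y x) by exact: nuE (VV0 _ Vyx) (yb x Ax).
have s0 := transversal _ Vyx; rewrite -vE in s0.
have goE' := goE _ Vyx; rewrite -vE in goE'.
have gov : go v = dot z0 v by rewrite dotC; exact: nbhs_singleton goE'.
have go_diff : frechet go v (dot^~ z0).
  have := is_diff_frechet (is_diff_dot z0 v); apply: small_at_eq.
  by apply: filterS goE' => u uE; rewrite -uE gov dotC.
have go_grad := frechet_grad go_diff.
have [dgo _] := frechet_dot_is_diff go_diff.
have XE : Xmx K v = (dot z0 v)^-1 *: (z0^T *m v).
  by rewrite /Xmx -/go gov go_grad.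
have rayE : ray_grad Phi z0 (y x) = (dot z0 v)^-1 *: v by rewrite /ray_grad -vE.
have y_diff u : A u -> is_diff u y (mulmxr (1%:M - (ray_grad Phi z0 (y u))^T *m z0)).
  move=> Au; apply: is_diff_eq (ray_is_diff ld transversal oA L0 y_lip yV yb Au) _.
  by apply/funext => w; rewrite /= mulmxBr mulmx1 mul_outer.
have jac_y : 1%:M - (ray_grad Phi z0 (y x))^T *m z0 = (1%:M - Xmx K v)^T.
  rewrite XE rayE; apply/matrixP => i j.
  by rewrite !mxE !big_ord1 !mxE eq_sym; ring.
split=> //.
- by have [d1 ->] := rho_grad x Ax; rewrite gov rayE.
- split; first by have [] := y_diff x Ax.
  by rewrite /Dmx (jacobian_eq (y_diff x Ax)) jac_y trmxK.
case: k ld {U_reg ld0} => [//|j] ld _.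
exists ((jac (unormal Phi) (y x))^T *m (1%:M - (unormal Phi (y x))^T *m unormal Phi (y x))).
split; first exact: (edist_hessian ld alpha_le1 U_open U_bounded Vyx (yb x Ax)).
have G_diff : is_diff (y x) (ray_grad Phi z0) (mulmxr (jac (ray_grad Phi z0) (y x))).
  apply: frechet_is_diff; apply: strict_jac_frechet; apply: strict_jac_of_entries => i.
  exact: Ckalpha_strict_grad oV (ray_grad_regular ld alpha_le1 transversal i) Vyx.
have comp_diff : is_diff x (ray_grad Phi z0 \o y)
    (mulmxr ((1%:M - Xmx K v)^T *m jac (ray_grad Phi z0) (y x))).
  apply: is_diff_eq (is_diff_comp (y_diff x Ax) G_diff) _.
  by apply/funext => w /=; rewrite jac_y mulmxA.
have grad_diff : is_diff x (grad (gauge_dist K U))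
    (mulmxr ((1%:M - Xmx K v)^T *m jac (ray_grad Phi z0) (y x))).
  apply: frechet_is_diff; have := is_diff_frechet comp_diff; apply: small_at_eq.
  have An : nbhs x A by exact: open_nbhs_nbhs.
  by apply: filterS An => u Au; rewrite !(rho_grad _ _).2.
rewrite /hessian /Dmx (jacobian_eq grad_diff).
have s_neq0 : dot z0 (unormal Phi (y x)) != 0 by rewrite -vE gt_eqF.
rewrite (jac_ray_grad ld alpha_le1 Vyx s_neq0) gov XE vE.
exact: hessian_algebra.
Qed.
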